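(* Let $R>0$ and let $\gamma=1+\sqrt2$. There exists $n_0$ (depending on $R$) such that for every integer $n\ge n_0$ and every $f\in\mathcal{F}_n(R)$, if $N$ is a Poisson process on $\mathbb{R}$ with intensity $nf$ with respect to Lebesgue measure, then the Haar thresholding estimator satisfies $$\mathbb{E}\big(\|\tilde f^H_{n,\gamma}-f\|_2^2\big)\le 12\ln n\Big[\sum_{\lambda\in\Gamma_n}\min(\beta_\lambda^2,V_{\lambda,n})+\frac1n\Big].$$
   Context: Haar basis: $\phi=1_{[0,1]}$, $\psi=1_{[0,1/2]}-1_{(1/2,1]}$, $\phi_k(x)=\phi(x-k)$, $\psi_{j,k}(x)=2^{j/2}\psi(2^jx-k)$ ($j\ge0$, $k\in\mathbb{Z}$). $\Lambda=\{(j,k):j\ge-1,k\in\mathbb{Z}\}$; $\varphi_\lambda=\phi_k$ if $\lambda=(-1,k)$ and $\varphi_\lambda=\psi_{j,k}$ if $\lambda=(j,k)$, $j\ge0$. For $f\in L_2$, $\beta_\lambda=\int\varphi_\lambda f$; $F_\lambda=\int_{\{\varphi_\lambda\ne0\}}f$. $\mathcal{F}_n(R)$ ($n\ge2$, $R>0$): nonnegative $f$ with $\|f\|_1,\|f\|_2,\|f\|_\infty\le R$ and $F_\lambda\ge\frac{(\ln n)(\ln\ln n)}{n}1_{\{\beta_\lambda\ne0\}}$ for all $\lambda\in\Lambda$. Observations: a Poisson process $N$ on $\mathbb{R}$ with mean measure $nf(x)dx$. Define $\hat\beta_\lambda=\frac1n\sum_{T\in N}\varphi_\lambda(T)$, $\hat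 V_{\lambda,n}=\frac1{n^2}\sum_{T\in N}\varphi_\lambda^2(T)$, $V_{\lambda,n}=\frac1n\int\varphi_\lambda^2f$, $$\tilde V_{\lambda,n}=\hat V_{\lambda,n}+\sqrt{2\gamma\ln n\,\hat V_{\lambda,n}\frac{\|\varphi_\lambda\|_\infty^2}{n^2}}+3\gamma\ln n\frac{\|\varphi_\lambda\|_\infty^2}{n^2},\qquad \eta_{\lambda,\gamma}=\sqrt{2\gamma\tilde V_{\lambda,n}\ln n}+\frac{\gamma\ln n}{3n}\|\varphi_\lambda\|_\infty.$$ Let $j_0$ be the integer with $2^{j_0}\le n<2^{j_0+1}$ and $\Gamma_n=\{(j,k)\in\Lambda: j\le j_0\}$. The estimator is $\tilde f^H_{n,\gamma}=\sum_{\lambda\in\Gamma_n}\hat\beta_\lambda 1_{\{|\hat\beta_\lambda|\ge\eta_{\lambda,\gamma}\}}\varphi_\lambda$. *)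

(* Defs.v *)
From HB Require Import structures.
From mathcomp Require Import all_boot all_order all_algebra.
From mathcomp Require Import all_classical all_reals all_analysis.
Set Implicit Arguments. Unset Strict Implicit. Unset Printing Implicit Defensive.
Import Order.TTheory GRing.Theory Num.Theory.
Import numFieldNormedType.Exports.
Local Open Scope classical_set_scope.
Local Open Scope ring_scope.

Section Haar.
Context {R : realType}.

Definition leb := (@lebesgue_measure R).

Definition haar_phi (x : R) : R := if (0 <= x <= 1) then 1 else 0.
Definition haar_psi (x : R) : R :=
  if (0 <= x <= 2^-1) then 1 else if (2^-1 < x <= 1) then -1 else 0.

(* lambda = (j,k); j = -1 : phi_k ; j >= 0 : psi_{j,k} = 2^{j/2} psi(2^j x - k).
   Only indices with j >= -1 are ever used (Lambda, Gamma_n). *)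
Definition varphi (l : int * int) (x : R) : R :=
  if (l.1 < 0)%R then haar_phi (x - l.2%:~R)
  else Num.sqrt (2 ^+ `|l.1|%N) * haar_psi (2 ^+ `|l.1|%N * x - l.2%:~R).

Definition Lambda : set (int * int) := [set l | (-1 <= l.1)%R].

Definition j0 (n : nat) : nat := trunc_log 2 n.

Definition Gamma (n : nat) : set (int * int) :=
  [set l | (-1 <= l.1)%R /\ (l.1 <= (j0 n)%:Z)%R].

Definition varphi_sup (l : int * int) : R := fine ('N[leb]_+oo[EFin \o varphi l])%E.

Definition beta (f : R -> R) (l : int * int) : R :=
  Rintegral leb setT (fun x => varphi l x * f x).

Definition bigF (f : R -> R) (l : int * int) : R :=
  Rintegral leb [set x | varphi l x != 0] f.

Definition V (n : nat) (f : R -> R) (l : int * int) : R :=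
  n%:R^-1 * Rintegral leb setT (fun x => (varphi l x) ^+ 2 * f x).

Definition Fclass (n : nat) (Rad : R) (f : R -> R) : Prop :=
  measurable_fun setT f /\
  (forall x, 0 <= f x) /\
  ('N[leb]_(1%:E)[EFin \o f] <= Rad%:E)%E /\
  ('N[leb]_(2%:E)[EFin \o f] <= Rad%:E)%E /\
  ('N[leb]_+oo[EFin \o f] <= Rad%:E)%E /\
  (forall l, Lambda l ->
     (ln n%:R * ln (ln n%:R) / n%:R) * (if beta f l != 0 then 1 else 0) <= bigF f l).

(* Poisson probabilities (with the correct convention at rate 0) *)
Definition poisson_p (mu : R) (k : nat) : R := mu ^+ k / k`!%:R * expR (- mu).

Definition npoints (s : seq R) (A : set R) : nat := count (fun t => t \in A) s.

(* N : Omega -> seq R is a Poisson process on R with intensity measure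
   A |-> \int_A g(x) dx  (g nonnegative integrable): for every finite family of
   pairwise disjoint Borel sets, the counts are jointly distributed as independent
   Poisson variables with means \int_{A_i} g. *)
Definition is_poisson_process {d} {Omega : measurableType d}
    (P : probability Omega R) (N : Omega -> seq R) (g : R -> R) : Prop :=
  (forall (A : set R) (k : nat), measurable A ->
     measurable [set w | npoints (N w) A = k]) /\
  (forall (m : nat) (A : 'I_m -> set R) (k : 'I_m -> nat),
     (forall i, measurable (A i)) ->
     (forall i j, i != j -> A i `&` A j = set0) ->
     P [set w | forall i, npoints (N w) (A i) = k i] =
       (\prod_(i < m) poisson_p (Rintegral leb (A i) g) (k i))%:E).

Definition beta_hat (n : nat) (s : seq R) (l : int * int) : R :=
  n%:R^-1 * \sum_(t <- s) varphi l t.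
Definition V_hat (n : nat) (s : seq R) (l : int * int) : R :=
  (n%:R ^+ 2)^-1 * \sum_(t <- s) (varphi l t) ^+ 2.
Definition V_tilde (n : nat) (gam : R) (s : seq R) (l : int * int) : R :=
  V_hat n s l
  + Num.sqrt (2 * gam * ln n%:R * V_hat n s l * (varphi_sup l ^+ 2 / n%:R ^+ 2))
  + 3 * gam * ln n%:R * (varphi_sup l ^+ 2 / n%:R ^+ 2).
Definition eta (n : nat) (gam : R) (s : seq R) (l : int * int) : R :=
  Num.sqrt (2 * gam * V_tilde n gam s l * ln n%:R)
  + gam * ln n%:R / (3 * n%:R) * varphi_sup l.

(* Haar thresholding estimator; the sum over Gamma_n has finite support at each x *)
Definition f_tilde (n : nat) (gam : R) (s : seq R) (x : R) : R :=
  \sum_(l \in Gamma n)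
    (if eta n gam s l <= `|beta_hat n s l| then beta_hat n s l else 0) * varphi l x.

End Haar.

(* Main.v *)
(* Haar coefficients of level beyond [j0 n] vanish on the class, since their [bigF] is at
   most [Rad / n].  By Lebesgue differentiation [f] is then almost everywhere the sum of its
   Haar expansion over [Gamma n], and by orthogonality the loss is the sum of the squared
   coefficient errors.

   In units of [amplitude / n], the coefficient [l] is the difference [S] of two independent
   Poisson counts with total [m]; its true value is [b], the mean of [m] is [a], and the
   threshold is a function of [m] alone.
   - If [b^2 <= a], conditionally on [m] Chernoff's bound gives acceptance probability of
     order [n^-1.1], hence a risk at most [2 b^2] plus a remainder of order
     [n^-1.1 (a^2 + a)].
   - If [a < b^2 <= 11 L a] with [L = ln n], the error is at most [(S - b)^2 + b^2].
   - If [11 L a < b^2], then [b] is far above the threshold, and a rejection costs no more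
     than a multiple of [(S - b)^2 + (m - a)^2].
   The last two cases use [a >= L ln L], which the class guarantees when [b] is nonzero.
   After rescaling, the remainders are at most [n^-1.1] times a multiple of [bigF], and
   [bigF] sums to at most [Rad] on each of the [O(ln n)] levels. *)
Require Import Defs.
From HB Require Import structures.
From mathcomp Require Import all_boot all_order all_algebra.
From mathcomp Require Import all_classical all_reals all_analysis.
From mathcomp Require Import measurable_realfun ess_sup_inf.
From mathcomp Require Import ring lra zify.
Import Order.TTheory GRing.Theory Num.Theory.
Import numFieldNormedType.Exports.
Set Implicit Arguments.
Unset Strict Implicit.
Unset Printing Implicit Defensive.
Local Open Scope classical_set_scope.
Local Open Scope ring_scope.

(** * Exponential bounds for moment generating functions *)

Section ExponentialInequalities.
Context {R : realType}.
Implicit Types t x y z r : R.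

(* If [e^s <= 1 + s + c s^2] then squaring gives the same kind of bound at [2 s], with
   the constant [(1 + 2 c) / 4] up to terms that are small with [s]. *)
Lemma expR_quadratic_doubling (c c' d t : R) : 0 <= c -> 0 <= d ->
  (1 + 2 * c) / 4 + c / 4 * d + (c * c) / 16 * (d * d) <= c' ->
  (forall s, `|s| <= d / 2 -> expR s <= 1 + s + c * s ^+ 2) ->
  `|t| <= d -> expR t <= 1 + t + c' * t ^+ 2.
Proof.
move=> c0 d0 cc' H td.
have -> : expR t = expR (t / 2) * expR (t / 2) by rewrite -expRD; congr expR; field.
have h2 : `|t / 2| <= d / 2 by rewrite normrM [`|2^-1|]ger0_norm ?invr_ge0// ler_pM2r.
have := H _ h2; set e := expR _ => le_e.
have e0 : 0 <= e by exact: expR_ge0.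
apply: (@le_trans _ _ ((1 + t / 2 + c * (t / 2) ^+ 2) ^+ 2)).
  by rewrite expr2 ler_pM.
have t2 : 0 <= t ^+ 2 by exact: sqr_ge0.
have tt : t * t ^+ 2 <= d * t ^+ 2 by rewrite ler_wpM2r// (le_trans (ler_norm _)).
have t3 : t ^+ 2 * t ^+ 2 <= d ^+ 2 * t ^+ 2.
  by rewrite ler_wpM2r// -[t ^+ 2]real_normK ?num_real// ler_pXn2r// nnegrE.
have tc : c * (t * t ^+ 2) <= c * (d * t ^+ 2) by rewrite ler_wpM2l.
have tc2 : c ^+ 2 * (t ^+ 2 * t ^+ 2) <= c ^+ 2 * (d ^+ 2 * t ^+ 2).
  by rewrite ler_wpM2l// sqr_ge0.
have cc2 := ler_wpM2r t2 cc'; rewrite -!expr2 in cc2.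
rewrite (_ : _ ^+ 2 = 1 + t + (1 + 2 * c) / 4 * t ^+ 2 + c / 4 * (t * t ^+ 2)
  + c ^+ 2 / 16 * (t ^+ 2 * t ^+ 2)); last by field.
lra.
Qed.

(** Near 0 the bound comes from [expR s * (1 - s) <= 1], with constant 8/7 for [|s| <= 1/8]. Three
    doublings carry it to [|t| <= 1], the constant falling to 9/10, 5/6 and then being rounded to
    1. *)
Lemma expR_le_quadratic t : `|t| <= 1 -> expR t <= 1 + t + t ^+ 2.
Proof.
move=> t1; rewrite -[X in _ + X]mul1r.
have H8 (s : R) : `|s| <= 1 / 8 -> expR s <= 1 + s + 8 / 7 * s ^+ 2.
  rewrite ler_norml => /andP[t1' t2].
  have := expR_ge1Dx (- s); have := expRxMexpNx_1 s; have := expR_gt0 s.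
  move: (expR s) (expR (- s)) => u v u0 uv le_v.
  have : u * (1 - s) <= 1 by rewrite -[leRHS]uv ler_pM2l.
  move=> le_u; rewrite -(@ler_pM2r _ (1 - s)); last lra.
  apply: (le_trans le_u); nra.
have H4 (s : R) : `|s| <= 1 / 4 -> expR s <= 1 + s + 9 / 10 * s ^+ 2.
  apply: (@expR_quadratic_doubling (8/7)); [lra|lra|lra|].
  by move=> r r2; apply: H8; lra.
have H2 (s : R) : `|s| <= 1 / 2 -> expR s <= 1 + s + 5 / 6 * s ^+ 2.
  apply: (@expR_quadratic_doubling (9/10)); [lra|lra|lra|].
  by move=> r r2; apply: H4; lra.
apply: (@expR_quadratic_doubling (5/6) _ 1) => //; lra.
Qed.

(** For [|t| <= 1] the quadratic bound applies to both exponentials; their linear terms leave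
    [(x - y) * t], which the imbalance [r] controls. For larger [|t|] already [|t| <= t ^+ 2]. *)
Lemma two_point_mgf (x y r t : R) : 0 <= x -> 0 <= y -> 0 <= r ->
  `|x - y| <= r * (x + y) ->
  x * expR t + y * expR (- t) <= (x + y) * expR (t ^+ 2 + r * `|t|).
Proof.
move=> x0 y0 r0 xy.
have a0 : 0 <= x + y by rewrite addr_ge0.
have [t1|/ltW t1] := leP `|t| 1.
  apply: (@le_trans _ _ ((x + y) * (1 + (t ^+ 2 + r * `|t|)))); last first.
    by rewrite ler_wpM2l// expR_ge1Dx.
  have := ler_wpM2l x0 (expR_le_quadratic t1).
  have := expR_le_quadratic (t := - t); rewrite normrN => /(_ t1) /(ler_wpM2l y0).
  have : (x - y) * t <= r * (x + y) * `|t|.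
    by rewrite (le_trans (ler_norm _))// normrM ler_wpM2r.
  by lra.
have tt : `|t| <= t ^+ 2 + r * `|t|.
  rewrite (@le_trans _ _ (t ^+ 2))// ?lerDl ?mulr_ge0//.
  by rewrite -[t ^+ 2]real_normK ?num_real// expr2 ler_peMl.
rewrite mulrDl lerD// ler_wpM2l// ler_expR (le_trans _ tt)//.
- exact: ler_norm.
- by rewrite -normrN ler_norm.
Qed.

Lemma sqr_le_2expR t : 0 <= t -> t ^+ 2 <= 2 * expR t.
Proof.
by move=> t0; have := @expR_ge1Dxn R t 1 t0; rewrite (_ : 2`!%:R = 2)//; lra.
Qed.

Lemma sqr_le_2expRD t : t ^+ 2 <= 2 * (expR t + expR (- t)).
Proof.
have [t0|/ltW t0] := leP 0 t.
  by have := sqr_le_2expR t0; have := expR_ge0 (- t); lra.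
have : 0 <= - t by rewrite oppr_ge0.
by move=> /sqr_le_2expR; rewrite sqrrN; have := expR_ge0 t; lra.
Qed.

End ExponentialInequalities.

(** * Expectations under two independent Poisson counts *)

Section PoissonPair.
Context {R : realType}.
Implicit Types (x y u v : R) (h : nat -> nat -> R).

(* [E h(X, Y)] for independent Poisson variables of means [x] and [y], summed along
   the diagonals [X + Y = m]. *)
Definition poisson2E x y h : \bar R :=
  (\sum_(0 <= m <oo)
    (\sum_(k < m.+1) poisson_p x k * poisson_p y (m - k) * h k (m - k)%N)%:E)%E.

Lemma poisson_p_ge0 x k : 0 <= x -> 0 <= poisson_p x k.
Proof. by move=> x0; rewrite /poisson_p mulr_ge0// ?expR_ge0// divr_ge0// exprn_ge0. Qed.

Lemma poisson_diagonal_ge0 x y h m : 0 <= x -> 0 <= y -> (forall k l, 0 <= h k l) ->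
  0 <= \sum_(k < m.+1) poisson_p x k * poisson_p y (m - k) * h k (m - k)%N.
Proof. by move=> x0 y0 h0; apply: sumr_ge0 => k _; rewrite mulr_ge0// mulr_ge0 ?poisson_p_ge0. Qed.

Lemma le_poisson2E x y h1 h2 : 0 <= x -> 0 <= y -> (forall k l, 0 <= h1 k l) ->
  (forall k l, h1 k l <= h2 k l) -> (poisson2E x y h1 <= poisson2E x y h2)%E.
Proof.
move=> x0 y0 h10 h12; apply: lee_nneseries => m _.
  by rewrite lee_fin poisson_diagonal_ge0.
by rewrite lee_fin; apply: ler_sum => k _; rewrite ler_wpM2l// mulr_ge0// poisson_p_ge0.
Qed.

Lemma poisson2ED x y h1 h2 : 0 <= x -> 0 <= y ->
  (forall k l, 0 <= h1 k l) -> (forall k l, 0 <= h2 k l) ->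
  poisson2E x y (fun k l => h1 k l + h2 k l) = (poisson2E x y h1 + poisson2E x y h2)%E.
Proof.
move=> x0 y0 h10 h20; rewrite /poisson2E -nneseriesD.
- apply: eq_eseriesr => m _; rewrite -EFinD -big_split/=; congr (_%:E).
  by apply: eq_bigr => k _; rewrite mulrDr.
- by move=> m _ _; rewrite lee_fin poisson_diagonal_ge0.
- by move=> m _ _; rewrite lee_fin poisson_diagonal_ge0.
Qed.

Lemma poisson2EZ x y c h : 0 <= x -> 0 <= y -> (forall k l, 0 <= h k l) ->
  poisson2E x y (fun k l => c * h k l) = (c%:E * poisson2E x y h)%E.
Proof.
move=> x0 y0 h0; rewrite /poisson2E -nneseriesZl.
- apply: eq_eseriesr => m _; rewrite -EFinM mulr_sumr; congr (_%:E).
  by apply: eq_bigr => k _; rewrite mulrCA.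
- by move=> m _; rewrite lee_fin poisson_diagonal_ge0.
Qed.

(** Binomial theorem: on the diagonal [k + l = m] the weights are, up to a common factor, those of a
    binomial law. Summed over [m], the right side is an exponential series. *)
Lemma poisson_diagonalE x y u v m :
  \sum_(k < m.+1) poisson_p x k * poisson_p y (m - k) * (u ^+ k * v ^+ (m - k)) =
  expR (- (x + y)) * ((x * u + y * v) ^+ m / m`!%:R).
Proof.
rewrite [x * u + _]addrC exprDn mulr_suml mulr_sumr; apply: eq_bigr => -[k /=].
rewrite ltnS => km _.
rewrite /poisson_p opprD expRD !exprMn -mulr_natr.
have -> : m`!%:R = 'C(m, k)%:R * (k`!%:R * (m - k)`!%:R) :> R.
  by rewrite -!natrM bin_fact.
have bin0 : 'C(m, k)%:R != 0 :> R by rewrite pnatr_eq0 -lt0n bin_gt0.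
have k0 : k`!%:R != 0 :> R by rewrite pnatr_eq0 -lt0n fact_gt0.
have mk0 : (m - k)`!%:R != 0 :> R by rewrite pnatr_eq0 -lt0n fact_gt0.
by field; rewrite bin0 k0 mk0.
Qed.

Lemma nneseries_expR (z : R) : 0 <= z ->
  (\sum_(0 <= m <oo) (z ^+ m / m`!%:R)%:E)%E = (expR z)%:E.
Proof.
move=> z0; rewrite /expR -EFin_lim; last exact: is_cvg_series_exp_coeff.
congr (limn _); apply/funext => n /=.
by rewrite /series/= sumEFin.
Qed.

Lemma poisson2E_mgf x y u v : 0 <= x -> 0 <= y -> 0 <= u -> 0 <= v ->
  poisson2E x y (fun k l => u ^+ k * v ^+ l) = (expR (x * u + y * v - (x + y)))%:E.
Proof.
move=> x0 y0 u0 v0; rewrite /poisson2E.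
under eq_eseriesr do rewrite poisson_diagonalE EFinM.
rewrite nneseriesZl => [|m _]; last first.
  by rewrite lee_fin divr_ge0// exprn_ge0// addr_ge0 ?mulr_ge0.
by rewrite nneseries_expR ?addr_ge0 ?mulr_ge0// -EFinM -expRD addrC.
Qed.

Lemma poisson2E_cst x y (c : R) : 0 <= x -> 0 <= y -> 0 <= c ->
  poisson2E x y (fun _ _ => c) = c%:E.
Proof.
move=> x0 y0 c0.
have -> : (fun _ _ => c) = (fun k l : nat => c * (1 ^+ k * 1 ^+ l)) :> (nat -> nat -> R).
  by apply/funext => k; apply/funext => l; rewrite !expr1n !mulr1.
by rewrite poisson2EZ ?poisson2E_mgf ?mulr1 ?subrr ?expR0 ?mule1// => k l; rewrite !expr1n mulr1.
Qed.

(** The logarithm of this moment is [x (e^s - 1 - s) + y (e^t - 1 - t)], at most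
    [x s^2 + y t^2 <= 1]. *)
Lemma poisson2E_exp_moment x y s t : 0 <= x -> 0 <= y -> 1 <= x + y ->
  `|s| <= (Num.sqrt (x + y))^-1 -> `|t| <= (Num.sqrt (x + y))^-1 ->
  (poisson2E x y (fun k l => expR (s * (k%:R - x) + t * (l%:R - y))%R) <= (expR 1)%:E)%E.
Proof.
move=> x0 y0 a1 hs ht.
have a0 : 0 < x + y by rewrite (lt_le_trans _ a1).
have sq1 : (Num.sqrt (x + y))^-1 <= 1.
  by rewrite invf_le1 ?sqrtr_gt0// -sqrtr1 ler_wsqrtr.
have sqr_le r : `|r| <= (Num.sqrt (x + y))^-1 -> r ^+ 2 <= (x + y)^-1.
  move=> hr; rewrite -[r ^+ 2]real_normK ?num_real//.
  rewrite -[X in _ <= X^-1](@sqr_sqrtr _ (x + y)) ?(ltW a0)// -exprVn.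
  by rewrite ler_pXn2r ?nnegrE ?invr_ge0 ?sqrtr_ge0.
have -> : (fun k l : nat => expR (s * (k%:R - x) + t * (l%:R - y))) =
    (fun k l => expR (- (s * x + t * y)) * (expR s ^+ k * expR t ^+ l)).
  apply/funext => k; apply/funext => l.
  by rewrite -!expRM_natl -!expRD; congr expR; ring.
rewrite poisson2EZ//.
rewrite poisson2E_mgf ?expR_ge0// -EFinM -expRD lee_fin ler_expR.
have es := ler_wpM2l x0 (expR_le_quadratic (le_trans hs sq1)).
have et := ler_wpM2l y0 (expR_le_quadratic (le_trans ht sq1)).
have s2 := ler_wpM2l x0 (sqr_le _ hs); have t2 := ler_wpM2l y0 (sqr_le _ ht).
have : x * (x + y)^-1 + y * (x + y)^-1 = 1 by rewrite -mulrDl divff// gt_eqF.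
by lra.
Qed.

(* By [u^2 <= 2 (e^u + e^-u)], the exponential moments at scale [1 / sqrt (x + y)] control
   the second moments. *)
Lemma poisson2E_second_moment x y (e : R) : 0 <= x -> 0 <= y -> 1 <= x + y ->
  `|e| = 1 ->
  (poisson2E x y (fun k l => (((k%:R - x) + e * (l%:R - y)) ^+ 2)%R)
     <= (4 * expR 1 * (x + y))%:E)%E.
Proof.
move=> x0 y0 a1 e1.
have a0 : 0 < x + y by rewrite (lt_le_trans _ a1).
pose s := (Num.sqrt (x + y))^-1.
have s0 : 0 <= s by rewrite invr_ge0 sqrtr_ge0.
have s2 : (x + y) * s ^+ 2 = 1 by rewrite exprVn sqr_sqrtr ?ltW// divff// gt_eqF.
have H r : `|r| = 1 -> (poisson2E x y
    (fun k l => expR (r * s * (k%:R - x) + r * s * e * (l%:R - y))%R) <= (expR 1)%:E)%E.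
  move=> r1; apply: poisson2E_exp_moment => //; rewrite !normrM r1 ?e1 ?mul1r ?mulr1.
  - by rewrite ger0_norm.
  - by rewrite ger0_norm.
apply: (@le_trans _ _ (poisson2E x y (fun k l => (2 * (x + y)) *
   (expR (1 * s * (k%:R - x) + 1 * s * e * (l%:R - y)) +
    expR (-1 * s * (k%:R - x) + -1 * s * e * (l%:R - y)))))).
  apply: le_poisson2E => // [k l|k l]; first exact: sqr_ge0.
  have := sqr_le_2expRD (s * ((k%:R - x) + e * (l%:R - y))).
  rewrite (_ : -1 * _ * _ + _ = - (s * ((k%:R - x) + e * (l%:R - y)))); last by ring.
  rewrite (_ : 1 * _ * _ + _ = (s * ((k%:R - x) + e * (l%:R - y)))); last by ring.
  move=> /(ler_wpM2l (ltW a0)); rewrite exprMn mulrA s2 mul1r.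
  by rewrite mulrA [(x + y) * 2]mulrC.
rewrite poisson2EZ//.
rewrite poisson2ED//.
apply: (@le_trans _ _ ((2 * (x + y))%:E * ((expR 1)%:E + (expR 1)%:E))%E).
  rewrite lee_pmul2l ?lte_fin// ?mulr_gt0// leeD// H// ?normrN normr1//.
by rewrite -EFinD -EFinM lee_fin; lra.
Qed.

End PoissonPair.

(** * Thresholding a difference of Poisson counts *)

Section CountThreshold.
Context {R : realType}.
Implicit Types (x y a b g r L : R) (k l m : nat).

(** This is [eta] in units of amplitude over [n], for a coefficient whose support carries [m]
    observations; see [etaE]. *)
Definition threshold g L m : R :=
  Num.sqrt (2 * g * (m%:R + Num.sqrt (2 * g * L * m%:R) + 3 * g * L) * L) + g * L / 3.

Definition kept g L k l : bool := threshold g L (k + l) <= `|k%:R - l%:R|.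

Definition threshold_loss g L b k l : R :=
  ((if kept g L k l then k%:R - l%:R else 0) - b) ^+ 2.

Lemma sqrtr_le_sqr (u v : R) : 0 <= v -> u <= v ^+ 2 -> Num.sqrt u <= v.
Proof. by move=> v0 uv; rewrite -(ger0_norm v0) -sqrtr_sqr ler_wsqrtr. Qed.

Lemma threshold_ge g L m : 0 <= g -> 0 <= L -> Num.sqrt (2 * g * L * m%:R) <= threshold g L m.
Proof.
move=> g0 L0; rewrite /threshold -[leLHS]addr0 lerD ?divr_ge0 ?mulr_ge0//.
rewrite ler_wsqrtr// -2!mulrA [leRHS]mulrAC -2![leRHS]mulrA.
rewrite !ler_wpM2l// -addrA lerDl addr_ge0 ?sqrtr_ge0//.
by rewrite !mulr_ge0.
Qed.

(* For [k + l] near [a] the threshold is about [sqrt (2 g L a)] with [2 g < 5], well below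
   [|b| > sqrt (11 L a)]: a rejection forces a large deviation of [k - l] or of [k + l]. *)
Lemma not_kept_le g L a b k l : 0 <= g -> g <= 121 / 50 -> 1 <= L -> 1000 * L <= a ->
  11 * L * a < b ^+ 2 -> ~~ kept g L k l ->
  b ^+ 2 <= 28 * ((k%:R - l%:R - b) ^+ 2 + (k%:R + l%:R - a) ^+ 2).
Proof.
move=> g0 g1 L1 La bLa; rewrite /kept -ltNge /threshold natrD.
set m : R := k%:R + l%:R; set S : R := k%:R - l%:R => ST.
have m0 : 0 <= m by rewrite addr_ge0.
have gL : g * L <= 121 / 50 * L by rewrite ler_wpM2r//; lra.
have gL0 : 0 <= g * L by rewrite mulr_ge0//; lra.
have gLm : g * L * m <= 121 / 50 * L * m by rewrite ler_wpM2r.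
(* Arithmetic-geometric mean: the product of 1/100 and 121 is a quarter of the bound 242/50 on
   [2 * g]. *)
have s1 : Num.sqrt (2 * g * L * m) <= m / 100 + 121 * L.
  by apply: sqrtr_le_sqr; [lra|have := sqr_ge0 (m / 100 - 121 * L); lra].
pose W := `|m - a|; have W0 : 0 <= W by exact: normr_ge0.
have mW : m <= a + W by have := ler_norm (m - a); rewrite -/W; lra.
(* The constant 28/5 exceeds [242/50 * (101/100 + 129/1000)], which governs the squared threshold at
   [m = a], and stays below 11 times the square of 5/7, so that [Q <= 5/7 * |b|]. *)
pose Q := Num.sqrt (28 / 5 * (L * a)).
have Q0 : 0 <= Q by rewrite sqrtr_ge0.
have Lap : 0 <= L * a by apply: mulr_ge0; lra.
have Q2 : Q ^+ 2 = 28 / 5 * (L * a) by apply: sqr_sqrtr; lra.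
have QL : 74 * L <= Q.
  rewrite /Q -[74 * L]ger0_norm; last lra.
  by rewrite -sqrtr_sqr ler_wsqrtr//; nra.
have s2 : Num.sqrt (2 * g * (m + Num.sqrt (2 * g * L * m) + 3 * g * L) * L) <= Q + W / 25.
  apply: sqrtr_le_sqr; first lra.
  have QLW : 74 * L * W <= Q * W by rewrite ler_wpM2r.
  have W2 : 0 <= W ^+ 2 by exact: sqr_ge0.
  apply: (@le_trans _ _ (2 * (121 / 50) * L * (101 / 100 * m + 129 / 1000 * a))).
    rewrite -[2 * g * _ * L]mulrA [(_ + _ + _) * L]mulrC !mulrA.
    have U0 : 0 <= 101 / 100 * m + 129 / 1000 * a by lra.
    apply: (@le_trans _ _ (2 * g * L * (101 / 100 * m + 129 / 1000 * a))).
      by rewrite ler_wpM2l//; [lra|lra].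
    by rewrite ler_wpM2r//; lra.
  have LmW : L * m <= L * (a + W) by rewrite ler_wpM2l//; lra.
  have LW0 : 0 <= L * W by rewrite mulr_ge0//; lra.
  rewrite sqrrD Q2; lra.
have Qb : Q <= 5 / 7 * `|b|.
  have -> : 5 / 7 * `|b| = Num.sqrt ((5 / 7) ^+ 2 * b ^+ 2).
    by rewrite -exprMn sqrtr_sqr normrM ger0_norm//; lra.
  by rewrite ler_wsqrtr//; lra.
have Sb : `|b| <= `|S| + `|S - b|.
  by have := ler_normB S (S - b); rewrite opprB addrC subrK.
(* After [Q <= 5/7 * |b|] and the lower-order [g * L / 3 <= Q / 74], at least 27/100 of [|b|] is
   left for the deviations. The factor 28 of the conclusion exceeds 2 over the square of 27/100. *)
have bound : 27 / 100 * `|b| <= `|S - b| + W by lra.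
have u0 : 0 <= `|S - b| by [].
rewrite -[b ^+ 2]real_normK ?num_real// -[(S - b) ^+ 2]real_normK ?num_real//.
rewrite -[(m - a) ^+ 2]real_normK ?num_real// -/W.
have b0 : 0 <= `|b| by [].
move: bound W0 u0 b0; clear; move: (`|b|) (`|S - b|) W => B u w *.
have : (27 / 100 * B) ^+ 2 <= (u + w) ^+ 2 by rewrite ler_pXn2r ?nnegrE//; lra.
have : 0 <= (u - w) ^+ 2 by exact: sqr_ge0.
have : 0 <= u ^+ 2 by exact: sqr_ge0.
have : 0 <= w ^+ 2 by exact: sqr_ge0.
by lra.
Qed.

(* Conditionally on [X + Y = m] this is Chernoff's bound with parameter
   [t = sqrt (g L / (2 m))], for which [t * threshold >= g L] and [m t^2 = g L / 2]. *)
Lemma kept_diagonal_le g L x y r m : 12 / 5 <= g -> g <= 5 / 2 -> 0 <= L ->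
  0 <= x -> 0 <= y -> 0 <= r -> `|x - y| <= r * (x + y) ->
  \sum_(k < m.+1) poisson_p x k * poisson_p y (m - k) *
    (if kept g L k (m - k) then (k%:R - (m - k)%:R) ^+ 2 else 0) <=
  2 * expR (- (x + y)) * expR (- (11 / 10 * L)) *
    (m%:R ^+ 2 * expR (5 * r ^+ 2 * m%:R) * (x + y) ^+ m / m`!%:R).
Proof.
move=> g1 g2 L0 x0 y0 r0 xy.
have g0 : 0 <= g by lra.
have a0 : 0 <= x + y by rewrite addr_ge0.
(* For [m = 0] the left side vanishes; it is set apart because the parameter [t] below divides by
   [m]. *)
case: m => [|m'].
  rewrite big_ord1 subnn subrr expr0n/= if_same mulr0.
  by rewrite !mulr_ge0 ?expR_ge0.
set m := m'.+1.
have m0 : 0 < m%:R :> R by rewrite ltr0n.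
pose t := Num.sqrt (g * L / (2 * m%:R)).
have t0 : 0 <= t by rewrite sqrtr_ge0.
have gL0 : 0 <= g * L by rewrite mulr_ge0.
have mt2 : m%:R * t ^+ 2 = g * L / 2.
  rewrite sqr_sqrtr ?divr_ge0// ?mulr_ge0// ?(ltW m0)//.
  by field; rewrite gt_eqF.
have tT : g * L <= t * threshold g L m.
  apply: (@le_trans _ _ (t * Num.sqrt (2 * g * L * m%:R))).
    rewrite -sqrtrM ?divr_ge0// ?mulr_ge0// ?(ltW m0)//.
    rewrite (_ : _ / _ * _ = (g * L) ^+ 2); last by field; rewrite gt_eqF.
    by rewrite sqrtr_sqr ler_norm.
  by rewrite ler_wpM2l// threshold_ge.
(* Two-sided Markov bound: a kept pair has [g L <= t |S|], so [e^(t S) + e^(- t S)] times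
   [e^(- g L)] is at least 1, while [S^2 <= m^2]. *)
apply: (@le_trans _ _ (m%:R ^+ 2 * expR (- (g * L)) *
  (\sum_(k < m.+1) poisson_p x k * poisson_p y (m - k) *
     (expR t ^+ k * expR (- t) ^+ (m - k)) +
   \sum_(k < m.+1) poisson_p x k * poisson_p y (m - k) *
     (expR (- t) ^+ k * expR t ^+ (m - k))))).
  rewrite -big_split/= mulr_sumr; apply: ler_sum => -[k /=]; rewrite ltnS => km _.
  rewrite -mulrDr [leRHS]mulrCA.
  apply: ler_wpM2l; first by apply: mulr_ge0; exact: poisson_p_ge0.
  rewrite -!expRM_natl -!expRD natrB//.
  case: ifPn => [|_]; last by rewrite !mulr_ge0 ?addr_ge0 ?expR_ge0// exprn_ge0.
  rewrite /kept subnKC// natrB// => kk.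
  set S : R := k%:R - (m%:R - k%:R); rewrite -/S in kk.
  have -> : k%:R * t + (m%:R - k%:R) * - t = t * S by rewrite /S; ring.
  have -> : k%:R * - t + (m%:R - k%:R) * t = - (t * S) by rewrite /S; ring.
  have S2 : S ^+ 2 <= m%:R ^+ 2.
    rewrite -[S ^+ 2]real_normK ?num_real// ler_pXn2r ?nnegrE ?(ltW m0)//.
    have km' : k%:R <= m%:R :> R by rewrite ler_nat.
    have k0' : 0 <= k%:R :> R by [].
    by rewrite ler_norml /S; lra.
  rewrite -mulrA -[leLHS]mulr1 ler_pM// ?sqr_ge0//.
  rewrite mulrDr -!expRD.
  have gLS : g * L <= t * `|S| by rewrite (le_trans tT)// ler_wpM2l.
  have [S0|/ltW S0] := leP 0 S.
    rewrite ger0_norm// in gLS.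
    by rewrite -[leLHS]addr0 lerD ?expR_ge0// -expR0 ler_expR; lra.
  rewrite ler0_norm// in gLS.
  by rewrite -[leLHS]add0r lerD ?expR_ge0// -expR0 ler_expR; lra.
rewrite !poisson_diagonalE.
(* The exponent is [m t^2 + r m t], where [m t^2 = g L / 2] and, by the arithmetic-geometric mean,
   [r m t <= L / 10 + 5 r^2 m]. As [g >= 12/5], the other half of [g L] covers
   [11/10 L + L / 10]. *)
have mgf (z : R) : 0 <= z -> z <= (x + y) * expR (t ^+ 2 + r * t) ->
    z ^+ m <= (x + y) ^+ m * expR (- (11 / 10 * L) + g * L + 5 * r ^+ 2 * m%:R).
  move=> z0 zle; apply: (@le_trans _ _ (((x + y) * expR (t ^+ 2 + r * t)) ^+ m)).
    by rewrite ler_pXn2r ?nnegrE// mulr_ge0 ?expR_ge0.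
  rewrite exprMn ler_wpM2l ?exprn_ge0// -expRM_natl ler_expR.
  rewrite mulrDr mt2.
  have -> : m%:R * (r * t) = r * (m%:R * t) by ring.
  have gL2 : 12 / 5 * L <= g * L by rewrite ler_wpM2r.
  suff : r * (m%:R * t) <= L / 10 + 5 * r ^+ 2 * m%:R by lra.
  have -> : r * (m%:R * t) = Num.sqrt (r ^+ 2 * (m%:R ^+ 2 * t ^+ 2)).
    by rewrite -!exprMn sqrtr_sqr ger0_norm// !mulr_ge0// ltW.
  apply: sqrtr_le_sqr.
    by rewrite addr_ge0 ?divr_ge0 ?mulr_ge0 ?sqr_ge0.
  rewrite (_ : m%:R ^+ 2 * t ^+ 2 = m%:R * (g * L / 2)); last by rewrite -mt2; ring.
  have gL3 : g * L <= 5 / 2 * L by rewrite ler_wpM2r.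
  have q0 : 0 <= r ^+ 2 * m%:R by rewrite mulr_ge0 ?sqr_ge0.
  have := mulr_ge0 q0 L0; have := ler_wpM2l q0 gL3.
  by clear -q0; have := sqr_ge0 (L / 10 - 5 * r ^+ 2 * m%:R); lra.
have m1 := two_point_mgf t x0 y0 r0 xy.
have m2 := two_point_mgf (- t) x0 y0 r0 xy.
rewrite normrN sqrrN opprK ger0_norm// in m2; rewrite ger0_norm// in m1.
have {}m1 := mgf _ _ m1; have {}m2 := mgf _ _ m2.
have f0 : 0 <= m`!%:R^-1 :> R by rewrite invr_ge0.
rewrite -mulrDr -mulrDl.
have /(ler_wpM2r f0) : (x * expR t + y * expR (- t)) ^+ m + (x * expR (- t) + y * expR t) ^+ m
   <= 2 * ((x + y) ^+ m * expR (- (11 / 10 * L) + g * L + 5 * r ^+ 2 * m%:R)).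
  by rewrite mulr2n mulrDl !mul1r lerD// ?m1 ?m2// addr_ge0 ?mulr_ge0 ?expR_ge0.
move=> /(ler_wpM2l (expR_ge0 (- (x + y)))) H.
have c0 : 0 <= m%:R ^+ 2 * expR (- (g * L)) by rewrite mulr_ge0 ?expR_ge0 ?sqr_ge0.
apply: (le_trans (ler_wpM2l c0 H)).
rewrite !expRD expRN le_eqVlt; apply/orP; left; apply/eqP.
by field; rewrite !gt_eqF ?expR_gt0// ltr0n fact_gt0.
Qed.

(** One summand for each regime of [kept_sum_le]: total mean at least 1, and at most 1. *)
Definition small_risk_cst : R := 4 * expR (6 * expR 6) + 4 * expR (expR 1).

(** The factor [m^2 e^(5 r^2 m)] of the diagonal bound is absorbed into a geometric factor, so that
    the diagonals are dominated by an exponential series with sum [c e^z]. *)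
Lemma kept_sum_le g L x y r : 12 / 5 <= g -> g <= 5 / 2 -> 0 <= L ->
  0 <= x -> 0 <= y -> 0 <= r -> `|x - y| <= r * (x + y) ->
  (1 <= x + y /\ r ^+ 2 * (x + y) <= 1) \/ (x + y <= 1 /\ r = 0) ->
  (poisson2E x y (fun k l => if kept g L k l then (k%:R - l%:R) ^+ 2 else 0)%R <=
    (small_risk_cst * (expR (- (11 / 10 * L)) * ((x + y) ^+ 2 + (x + y))))%:E)%E.
Proof.
move=> g1 g2 L0 x0 y0 r0 xy hr.
have a0 : 0 <= x + y by rewrite addr_ge0.
set a := x + y in a0 *; set E := expR (- (11 / 10 * L)).
have E0 : 0 <= E by exact: expR_ge0.
have K1 : 0 <= expR (6 * expR 6) :> R by exact: expR_ge0.
have K2 : 0 <= expR (expR 1) :> R by exact: expR_ge0.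
have a20 : 0 <= a ^+ 2 by exact: sqr_ge0.
have diag0 m : 0 <= \sum_(k < m.+1) poisson_p x k * poisson_p y (m - k) *
    (if kept g L k (m - k) then (k%:R - (m - k)%:R) ^+ 2 else 0).
  by apply: (@poisson_diagonal_ge0 _ x y (fun k l =>
     if kept g L k l then (k%:R - l%:R) ^+ 2 else 0)) => // k l; case: ifP => // _; exact: sqr_ge0.
suff [c [z [c0 z0 term fin]]] : exists c z : R, [/\ 0 <= c, 0 <= z,
   forall m, 2 * expR (- a) * E * (m%:R ^+ 2 * expR (5 * r ^+ 2 * m%:R) * a ^+ m / m`!%:R)
      <= c * (z ^+ m / m`!%:R) &
   c * expR z <= small_risk_cst * (E * (a ^+ 2 + a))].
  apply: (@le_trans _ _ (\sum_(0 <= m <oo) (c%:E * (z ^+ m / m`!%:R)%:E))%E).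
    apply: lee_nneseries => m _; first by rewrite lee_fin.
    by rewrite -EFinM lee_fin (le_trans _ (term m))// kept_diagonal_le.
  rewrite nneseriesZl => [|m _]; last by rewrite lee_fin divr_ge0// exprn_ge0.
  by rewrite nneseries_expR// -EFinM lee_fin.
case: hr => [[a1 ra]|[a1 r00]].
  have ap : 0 < a by rewrite (lt_le_trans _ a1).
  (* The bounds [m^2 <= 2 a^2 e^(m/a)] and [r^2 <= 1/a] cost a factor [e^(6/a)] per point. Since
     [a (e^(6/a) - 1) <= 6 e^6], the product [e^(-a) e^z] stays bounded. *)
  exists (4 * a ^+ 2 * expR (- a) * E), (a * expR (6 / a)); split.
  - by rewrite !mulr_ge0 ?expR_ge0.
  - by rewrite mulr_ge0 ?expR_ge0.
  - move=> m; rewrite exprMn -expRM_natl.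
    have H1 : m%:R ^+ 2 <= 2 * a ^+ 2 * expR (m%:R / a).
      have /sqr_le_2expR/(ler_wpM2l a20) : 0 <= m%:R / a :> R by rewrite divr_ge0.
      by rewrite -exprMn mulrC divfK ?gt_eqF// mulrCA mulrA.
    have H2 : expR (5 * r ^+ 2 * m%:R) <= expR (5 * (m%:R / a)).
      rewrite ler_expR -mulrA ler_wpM2l// mulrC ler_wpM2l//.
      by rewrite -(ler_pM2r ap) mulVf ?gt_eqF.
    have H3 : m%:R ^+ 2 * expR (5 * r ^+ 2 * m%:R) <= 2 * a ^+ 2 * expR (m%:R * (6 / a)).
      rewrite (_ : m%:R * (6 / a) = m%:R / a + 5 * (m%:R / a)); last by field; rewrite gt_eqF.
      by rewrite expRD mulrA ler_pM ?sqr_ge0 ?expR_ge0.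
    have f0 : 0 <= 2 * expR (- a) * E * (a ^+ m / m`!%:R).
      by rewrite mulr_ge0 ?mulr_ge0 ?expR_ge0// ?divr_ge0 ?exprn_ge0.
    by have := ler_wpM2l f0 H3; lra.
  - have ea : a * expR (6 / a) - a <= 6 * expR 6.
      set s := 6 / a.
      have s6 : s <= 6 by rewrite /s ler_pdivrMr// ler_peMr.
      have s0 : 0 <= s by rewrite divr_ge0.
      have as6 : a * s = 6 by rewrite /s mulrC divfK// gt_eqF.
      have : expR s - 1 <= s * expR s.
        have := expR_ge1Dx (- s); have := expRxMexpNx_1 s; have := expR_gt0 s.
        move: (expR s) (expR (- s)) => u v u0 uv le_v.
        have := ler_wpM2l (ltW u0) le_v; lra.
      move=> /(ler_wpM2l a0); rewrite mulrA as6 mulrBr mulr1 => /le_trans; apply.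
      by rewrite ler_wpM2l// ler_expR.
    have : expR (- a) * expR (a * expR (6 / a)) <= expR (6 * expR 6).
      by rewrite -expRD ler_expR addrC.
    move=> H; have f0 : 0 <= 4 * a ^+ 2 * E by rewrite !mulr_ge0.
    have := ler_wpM2l f0 H; rewrite /small_risk_cst.
    have : 0 <= expR (6 * expR 6) * (E * a) by rewrite !mulr_ge0.
    have : 0 <= expR (expR 1) * (E * (a ^+ 2 + a)) by rewrite !mulr_ge0 ?addr_ge0.
    by lra.
(* The diagonal [m = 0] contributes nothing and [a^m <= a] for [m >= 1]. This produces the factor
   [a], which matters because [a] may be arbitrarily small. *)
exists (4 * a * E), (expR 1); split.
- by rewrite !mulr_ge0.
- exact: expR_ge0.
- move=> m; rewrite r00 expr0n/= mulr0 mul0r expR0 mulr1.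
  have ea : expR (- a) <= 1 by rewrite expR_le1 oppr_le0.
  have H1 : (m%:R : R) ^+ 2 <= 2 * expR 1 ^+ m.
    by have := @sqr_le_2expR R m%:R (ler0n _ _); rewrite -[X in expR X]mulr1 expRM_natl.
  have H2 : m%:R ^+ 2 * a ^+ m <= 2 * expR 1 ^+ m * a.
    case: m H1 => [|m] H1; first by rewrite expr0n/= mul0r !mulr_ge0.
    rewrite ler_pM ?sqr_ge0 ?exprn_ge0// exprS ler_piMr// exprn_ile1//.
  have f0 : 0 <= m`!%:R^-1 :> R by rewrite invr_ge0.
  have H3 : 0 <= m%:R ^+ 2 * a ^+ m by rewrite mulr_ge0 ?sqr_ge0 ?exprn_ge0.
  rewrite (_ : 4 * a * E * (expR 1 ^+ m / m`!%:R) =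
     2 * 1 * E * ((2 * expR 1 ^+ m * a) / m`!%:R)); last by ring.
  apply: ler_pM.
    by rewrite !mulr_ge0 ?expR_ge0.
    by rewrite mulr_ge0.
    by rewrite ler_wpM2r// ler_wpM2l.
  by rewrite ler_wpM2r.
- rewrite /small_risk_cst.
  have : 0 <= expR (6 * expR 6) * (E * (a ^+ 2 + a)) by rewrite !mulr_ge0 ?addr_ge0.
  have : 0 <= expR (expR 1) * (E * a ^+ 2) by rewrite !mulr_ge0 ?addr_ge0.
  by lra.
Qed.

Lemma threshold_loss_ge0 g L b k l : 0 <= threshold_loss g L b k l.
Proof. exact: sqr_ge0. Qed.

(** The lower bound serves the Chernoff exponent of [kept_diagonal_le], the upper one the comparison
    in [not_kept_le]. *)
Lemma gamma_bounds : 12 / 5 <= 1 + Num.sqrt 2 :> R /\ 1 + Num.sqrt 2 <= 121 / 50 :> R.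
Proof.
have s0 : 0 <= Num.sqrt 2 :> R by rewrite sqrtr_ge0.
have s2 : Num.sqrt 2 ^+ 2 = 2 :> R by rewrite sqr_sqrtr.
have h1 : 7 / 5 <= Num.sqrt 2 :> R.
  by rewrite -[leLHS]ger0_norm ?divr_ge0// -sqrtr_sqr ler_wsqrtr//; lra.
have h2 : Num.sqrt 2 <= 71 / 50 :> R by apply: sqrtr_le_sqr; lra.
by split; lra.
Qed.

(** Pointwise, the loss is at most [2 b^2] plus, on acceptance, twice the squared difference of the
    counts, whose mean [kept_sum_le] bounds. *)
Lemma count_risk_small L x y : 1 <= L -> 0 <= x -> 0 <= y ->
  (x - y != 0 -> 1 <= x + y) -> (x - y) ^+ 2 <= x + y ->
  (poisson2E x y (threshold_loss (1 + Num.sqrt 2) L (x - y)) <=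
    (2 * (x - y) ^+ 2 +
     2 * (small_risk_cst * (expR (- (11 / 10 * L)) * ((x + y) ^+ 2 + (x + y)))))%:E)%E.
Proof.
move=> L1 x0 y0 ha ba; have [g1 g2] := gamma_bounds.
set g := 1 + Num.sqrt 2 in g1 g2 *.
have a0 : 0 <= x + y by rewrite addr_ge0.
pose keptS k l : R := if kept g L k l then (k%:R - l%:R) ^+ 2 else 0.
have keptS0 k l : 0 <= keptS k l by rewrite /keptS; case: ifP => // _; exact: sqr_ge0.
have b20 : 0 <= (x - y) ^+ 2 by exact: sqr_ge0.
apply: (@le_trans _ _ (poisson2E x y (fun k l => 2 * (x - y) ^+ 2 + 2 * keptS k l))).
  apply: le_poisson2E => // [k l|k l]; first exact: threshold_loss_ge0.
  rewrite /threshold_loss /keptS; case: ifP => _; last by rewrite sub0r sqrrN; lra.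
  by have := sqr_ge0 (k%:R - l%:R + (x - y)); lra.
rewrite poisson2ED => //; [|by move=> *; rewrite mulr_ge0|by move=> *; rewrite mulr_ge0].
have b2' : 0 <= 2 * (x - y) ^+ 2 by lra.
rewrite poisson2E_cst//.
rewrite EFinD leeD2l//.
rewrite poisson2EZ// EFinM lee_wpmul2l ?lee_fin//.
(* Choice of [r]: 0 when the means agree, since the total may then be below 1; otherwise
   [1 / sqrt (x + y)], which bounds the relative imbalance because [(x - y)^2 <= x + y]. *)
have [/eqP b0|bN0] := boolP (x - y == 0).
  apply: (@kept_sum_le _ _ _ _ 0) => //; [lra|lra|by rewrite b0 normr0 mul0r|].
  by have [a1|/ltW a1] := leP 1 (x + y); [left; rewrite expr0n/= mul0r|right].
have a1 := ha bN0.
have sa : 0 < Num.sqrt (x + y) by rewrite sqrtr_gt0; lra.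
have sa2 : Num.sqrt (x + y) ^+ 2 = x + y by rewrite sqr_sqrtr.
apply: (@kept_sum_le _ _ _ _ (Num.sqrt (x + y))^-1) => //; [lra|lra|..].
- rewrite -[X in _ * X]sa2 expr2 mulKf ?gt_eqF//.
  by rewrite -sqrtr_sqr ler_wsqrtr.
- by left; split => //; rewrite exprVn sa2 mulVf// gt_eqF//; lra.
Qed.

(** Each centred second moment is at most [4 e (x + y)]. The middle regime costs
    [(4 e + 11 L) (x + y)], the far one [28 * 8 e (x + y)]; with [20 e <= L] both are at most
    [12 L (x + y)]. *)
Lemma count_risk_large L x y : 20 * expR 1 <= L -> 0 <= x -> 0 <= y ->
  1000 * L <= x + y -> x + y < (x - y) ^+ 2 ->
  (poisson2E x y (threshold_loss (1 + Num.sqrt 2) L (x - y)) <= (12 * L * (x + y))%:E)%E.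
Proof.
move=> Le x0 y0 La ab; have [g1 g2] := gamma_bounds.
set g := 1 + Num.sqrt 2 in g1 g2 *.
have e1 : 2 <= expR 1 :> R by have := expR_ge1Dx (1 : R); lra.
have a1 : 1 <= x + y by lra.
have S2 := @poisson2E_second_moment _ _ _ (-1) x0 y0 a1.
rewrite normrN1 in S2; have {}S2 := S2 erefl.
have M2 := @poisson2E_second_moment _ _ _ 1 x0 y0 a1.
rewrite normr1 in M2; have {}M2 := M2 erefl.
set hS := (fun k l : nat => _) in S2; set hM := (fun k l : nat => _) in M2.
have hS0 k l : 0 <= hS k l by exact: sqr_ge0.
have hM0 k l : 0 <= hM k l by exact: sqr_ge0.
have hSE k l : hS k l = (k%:R - l%:R - (x - y)) ^+ 2 by rewrite /hS; congr (_ ^+ 2); ring.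
have hME k l : hM k l = (k%:R + l%:R - (x + y)) ^+ 2 by rewrite /hM; congr (_ ^+ 2); ring.
have b20 : 0 <= (x - y) ^+ 2 by exact: sqr_ge0.
have La0 : 20 * expR 1 * (x + y) <= L * (x + y) by rewrite ler_wpM2r//; lra.
have ea0 : 0 <= expR 1 * (x + y) by rewrite mulr_ge0 ?expR_ge0//; lra.
have [bLa|bLa] := leP ((x - y) ^+ 2) (11 * L * (x + y)).
  apply: (@le_trans _ _ (poisson2E x y (fun k l => hS k l + (x - y) ^+ 2))).
    apply: le_poisson2E => // [k l|k l]; first exact: threshold_loss_ge0.
    rewrite hSE /threshold_loss; case: ifP => _; first by rewrite lerDl.
    by rewrite sub0r sqrrN lerDr sqr_ge0.
  rewrite poisson2ED// poisson2E_cst//.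
  by apply: (le_trans (leeD2r _ S2)); rewrite -EFinD lee_fin; lra.
apply: (@le_trans _ _ (poisson2E x y (fun k l => 28 * (hS k l + hM k l)))).
  apply: le_poisson2E => // [k l|k l]; first exact: threshold_loss_ge0.
  rewrite hSE hME /threshold_loss; case: ifPn => kp.
    have := sqr_ge0 (k%:R + l%:R - (x + y)); have := sqr_ge0 (k%:R - l%:R - (x - y)).
    by lra.
  by rewrite sub0r sqrrN; apply: not_kept_le kp => //; lra.
rewrite poisson2EZ// => [|k l]; last by rewrite addr_ge0.
rewrite poisson2ED//.
apply: (@le_trans _ _ (28%:E * ((4 * expR 1 * (x + y))%:E + (4 * expR 1 * (x + y))%:E))%E).
  by rewrite lee_wpmul2l ?lee_fin// leeD.
by rewrite -EFinD -EFinM lee_fin; lra.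
Qed.

Lemma count_risk L x y : 20 * expR 1 <= L -> 0 <= x -> 0 <= y ->
  (x - y != 0 -> 1000 * L <= x + y) ->
  (poisson2E x y (threshold_loss (1 + Num.sqrt 2) L (x - y)) <=
    (12 * L * Num.min ((x - y) ^+ 2) (x + y) +
     2 * (small_risk_cst * (expR (- (11 / 10 * L)) * ((x + y) ^+ 2 + (x + y)))))%:E)%E.
Proof.
move=> Le x0 y0 ha.
have e1 : 2 <= expR 1 :> R by have := expR_ge1Dx (1 : R); lra.
have a0 : 0 <= x + y by rewrite addr_ge0.
have b20 : 0 <= (x - y) ^+ 2 by exact: sqr_ge0.
have [ba|ab] := leP ((x - y) ^+ 2) (x + y).
  apply: (le_trans (count_risk_small _ x0 y0 _ ba)); first lra.
    by move=> /ha; lra.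
  rewrite lee_fin lerD2r; have : 40 * (x - y) ^+ 2 <= L * (x - y) ^+ 2.
    by rewrite ler_wpM2r//; lra.
  by lra.
have bN0 : x - y != 0.
  by apply: contraTneq ab => ->; rewrite expr0n/= -leNgt.
apply: (le_trans (count_risk_large Le x0 y0 (ha bN0) ab)).
rewrite lee_fin lerDl !mulr_ge0 ?expR_ge0// ?addr_ge0 ?mulr_ge0 ?expR_ge0 ?sqr_ge0//.
Qed.

End CountThreshold.

(** * Countable sums and integrals of nonnegative functions *)

Section CountableSums.
Context {R : realType}.

(** The integral of a nonnegative function is a supremum over the simple functions below it, so
    monotonicity holds for arbitrary functions. The integrated loss is compared in this way, both
    over the line and over the outcomes. *)
Lemma le_integral_nneg d (T : measurableType d) (mu : {measure set T -> \bar R})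
    (f g : T -> \bar R) :
  (forall x, 0 <= f x)%E -> (forall x, f x <= g x)%E ->
  (\int[mu]_x f x <= \int[mu]_x g x)%E.
Proof.
move=> f0 fg; have g0 x : (0 <= g x)%E by rewrite (le_trans (f0 x)).
rewrite !ge0_integralTE//; apply: le_ereal_sup => _ [h hf <-].
by exists h => // x; rewrite (le_trans (hf x)).
Qed.

(** Reindexing by [pickle] turns the unordered sum into a series, with 0 at the numbers coding no
    element of [P]; measurability and monotone convergence for series then carry over. *)
Lemma esum_countE (T : countType) (P : set T) (a : T -> \bar R) :
  (forall t, 0 <= a t)%E ->
  \esum_(t in P) a t =
  (\sum_(0 <= i <oo) if i \in pickle @` P then oapp a 0 (@pickle_inv T i) else 0)%E.
Proof.
move=> a0; rewrite nneseries_esumT; last first.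
  by move=> i; case: ifP => // _; case: pickle_inv => [t|] /=.
rewrite -esum_mkcond esum_image; last by move=> x y _ _; exact: (pcan_inj pickleK_inv).
by apply: eq_esum => t _; rewrite pickleK_inv.
Qed.

Lemma measurable_esum d (X : measurableType d) (T : countType) (P : set T)
    (a : T -> X -> \bar R) :
  (forall t x, 0 <= a t x)%E -> (forall t, measurable_fun setT (a t)) ->
  measurable_fun setT (fun x => \esum_(t in P) a t x).
Proof.
move=> a0 ma; under eq_fun do rewrite esum_countE//.
apply: ge0_emeasurable_sum => [i x _ _|i _].
  by case: ifP => // _; case: pickle_inv => [t|] /=.
case: (i \in _); last exact: measurable_cst.
by case: pickle_inv => [t|] /=; [exact: ma|exact: measurable_cst].
Qed.

Lemma integral_esum d (X : measurableType d) (mu : {measure set X -> \bar R})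
    (T : countType) (P : set T) (a : T -> X -> \bar R) :
  (forall t x, 0 <= a t x)%E -> (forall t, measurable_fun setT (a t)) ->
  ((\int[mu]_x (\esum_(t in P) a t x)) = \esum_(t in P) (\int[mu]_x a t x))%E.
Proof.
move=> a0 ma.
under eq_integral do rewrite esum_countE//.
rewrite integral_nneseries//; last 2 first.
- move=> i; case: (i \in _); last exact: measurable_cst.
  by case: pickle_inv => [t|] /=; [exact: ma|exact: measurable_cst].
- by move=> i x _; case: ifP => // _; case: pickle_inv => [t|] /=.
rewrite esum_countE; last by move=> t; exact: integral_ge0.
apply: eq_eseriesr => i _; case: ifP => _; last by rewrite integral0.
by case: pickle_inv => [t|] //=; rewrite integral0.
Qed.

Lemma esum_eq1 (T : choiceType) (t : T) (a : T -> \bar R) :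
  (0 <= a t)%E -> (forall s, s <> t -> a s = 0%E) -> \esum_(s in setT) a s = a t.
Proof.
move=> a0 h; rewrite -(esum_set1 a0) [RHS]esum_mkcond.
by apply: eq_esum => s _; case: ifPn => //; rewrite notin_setE/= => /h.
Qed.

Lemma integral_fibers d (X : measurableType d) (mu : {measure set X -> \bar R})
    (T : countType) (A : T -> set X) (p : X -> T) (g : X -> \bar R) :
  (forall x, 0 <= g x)%E -> measurable_fun setT g ->
  (forall t, measurable (A t)) -> (forall t x, A t x <-> p x = t) ->
  ((\int[mu]_x g x) = \esum_(t in setT) (\int[mu]_(x in A t) g x))%E.
Proof.
move=> g0 mg mA Ap.
transitivity (\int[mu]_x (\esum_(t in setT) (g \_ (A t)) x))%E.
  apply: eq_integral => x _; rewrite (@esum_eq1 _ (p x)).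
  - by rewrite patchT// inE; apply/Ap.
  - by rewrite patchT// inE; apply/Ap.
  - by move=> t tp; rewrite patchN// notin_setE => /Ap /esym.
rewrite integral_esum; last 2 first.
- by move=> t x; rewrite patchE; case: ifP.
- by move=> t; apply/(measurable_restrictT _ (mA t)).1; apply: measurable_funS mg.
by apply: eq_esum => t _; rewrite [RHS]integral_mkcond.
Qed.

(** Serves to pair the two halves of each dyadic interval. *)
Lemma esum_parity (a : int -> \bar R) : (forall k, 0 <= a k)%E ->
  \esum_(k in setT) a k = \esum_(k in setT) (a (2 * k)%R + a (2 * k + 1)%R)%E.
Proof.
move=> a0; rewrite esumD//.
rewrite [LHS](esumID (range (fun k : int => 2 * k)))// !setTI; congr (_ + _)%E.
- by rewrite esum_image// => x y _ _; lia.
- rewrite (_ : ~` _ = range (fun k : int => 2 * k + 1)).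
    by rewrite esum_image// => x y _ _; lia.
  apply/seteqP; split => [k /= kE|k [q _ <-] [r _]]; last by lia.
  have /orP[/eqP h|/eqP h] : ((k %% 2)%Z == 0) || ((k %% 2)%Z == 1) by lia.
  + by exfalso; apply: kE; exists (k %/ 2)%Z => //; lia.
  + by exists (k %/ 2)%Z => //; lia.
Qed.

Lemma esum_cmul (T : countType) (P : set T) (c : R) (a : T -> \bar R) :
  (forall t, 0 <= a t)%E -> 0 <= c ->
  \esum_(t in P) (c%:E * a t)%E = (c%:E * \esum_(t in P) a t)%E.
Proof.
move=> a0 c0; rewrite !esum_countE//; last by move=> t; rewrite mule_ge0.
rewrite -nneseriesZl; last by move=> i _; case: ifP => // _; case: pickle_inv.
apply: eq_eseriesr => i _; case: ifP => _; last by rewrite mule0.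
by case: pickle_inv => [t|] //=; rewrite mule0.
Qed.

End CountableSums.

(** * Haar indices, dyadic intervals and finite Haar expansions *)

Section HaarIndices.
Context {R : realType}.
Implicit Types (i j J : nat) (k : int) (l : int * int) (x : R).

(* Level [0] is the scaling level [j = -1] of the paper and level [j.+1] its level [j]. *)
Definition haar_index i k : int * int := (if i is j.+1 then j%:Z else -1, k).

(** Absolute value of the Haar functions of level [i] on their supports. *)
Definition amplitude i : R := if i is j.+1 then Num.sqrt (2 ^+ j) else 1.

Definition dyadic_floor j x : int := Num.floor (2 ^+ j * x).

Definition dyadic j k : set R := [set x | dyadic_floor j x = k].

Lemma GammaE n : Gamma n = \bigcup_(i in `I_(j0 n).+2) range (haar_index i).
Proof.
apply/seteqP; split => [[j k] [/= h1 h2]|_ [i /= iJ [k _ <-]]].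
  case: j h1 h2 => [j|[|j]] //= h1 h2.
  - by exists j.+1 => /=; [lia|exists k].
  - by exists 0%N => //=; exists k.
by case: i iJ => [|i] /= iJ; split => //=; lia.
Qed.

Lemma haar_index_inj i i' k k' : haar_index i k = haar_index i' k' -> i = i' /\ k = k'.
Proof.
move=> h; move: (congr1 fst h) (congr1 snd h) => /=.
by case: i {h} => [|i]; case: i' => [|i'] //= E ->; split => //; lia. Qed.

Lemma esum_Gamma n (a : int * int -> \bar R) : (forall l, 0 <= a l)%E ->
  \esum_(l in Gamma n) a l =
  (\sum_(i < (j0 n).+2) \esum_(k in setT) a (haar_index i k))%E.
Proof.
move=> a0; rewrite GammaE esum_bigcupT//; last first.
  move=> i i' _ _ [_ [[k _ <-] [k' _ /esym]]].
  by move=> /haar_index_inj[].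
rewrite esum_fset//; last by move=> i _; exact: esum_ge0.
rewrite -fsbig_ord; apply: eq_bigr => i _.
by rewrite esum_image// => k k' _ _ /haar_index_inj[].
Qed.

(** Value, on the [k]th dyadic interval of length [2^-J], of the Haar series with coefficients [c]
    truncated at level [J]: the value on the parent, plus the finest term on its left half and minus
    it on its right half. *)
Fixpoint haar_value (c : nat -> int -> R) J k : R :=
  if J is j.+1 then
    haar_value c j (k %/ 2)%Z +
    (if (k %% 2)%Z == 0 then 1 else -1) * amplitude j.+1 * c j.+1 (k %/ 2)%Z
  else c 0%N k.

Lemma haar_valueB c c' J k :
  haar_value (fun i k => c i k - c' i k) J k = haar_value c J k - haar_value c' J k.
Proof. by elim: J k => //= J IH k; rewrite IH; ring. Qed.

Lemma amplitude_ge0 i : 0 <= amplitude i.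
Proof. by case: i => //= j; rewrite sqrtr_ge0. Qed.

Lemma amplitude_sqr j : amplitude j.+1 ^+ 2 = 2 ^+ j.
Proof. by rewrite sqr_sqrtr// exprn_ge0. Qed.

(** Parseval's identity by induction on the level: the values on the two halves of an interval are
    [u + v] and [u - v], whose squares add up to [2 (u^2 + v^2)], and [v^2] is [2^J] times a squared
    coefficient. *)
Lemma haar_energy c J :
  \esum_(k in setT) ((2 ^+ J)^-1 * haar_value c J k ^+ 2)%:E =
  (\sum_(i < J.+1) \esum_(k in setT) (c i k ^+ 2)%:E)%E.
Proof.
elim: J => [|J IH].
  by rewrite big_ord1; apply: eq_esum => k _ /=; rewrite expr0 invr1 mul1r.
have p0 : 0 < 2 ^+ J :> R by rewrite exprn_gt0.
rewrite big_ord_recr/= -IH -esumD; last 2 first.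
- by move=> k _; rewrite lee_fin mulr_ge0 ?invr_ge0 ?sqr_ge0// ltW.
- by move=> k _; rewrite lee_fin sqr_ge0.
rewrite [LHS]esum_parity; last first.
  by move=> k; rewrite lee_fin mulr_ge0 ?invr_ge0 ?sqr_ge0// exprn_ge0.
apply: eq_esum => k _; rewrite -!EFinD; congr (_%:E).
have -> : ((2 * k) %/ 2)%Z = k by lia.
have -> : ((2 * k + 1) %/ 2)%Z = k by lia.
have -> : ((2 * k) %% 2)%Z == 0 by lia.
have -> : (((2 * k + 1) %% 2)%Z == 0) = false by lia.
have := amplitude_sqr J => /=; set s := Num.sqrt _ => s2.
rewrite exprS invfM.
rewrite (_ : _ * _ + _ = (2 ^+ J)^-1 * (haar_value c J k ^+ 2 + s ^+ 2 * c J.+1 k ^+ 2)).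
  by rewrite s2; field; rewrite gt_eqF.
by field; rewrite gt_eqF.
Qed.

Lemma dyadicE j k : dyadic j k =
  `[k%:~R / 2 ^+ j, (k + 1)%:~R / 2 ^+ j[%classic.
Proof.
have p0 : 0 < 2 ^+ j :> R by rewrite exprn_gt0.
apply/seteqP; split => x; rewrite /dyadic /dyadic_floor /= in_itv/=.
  move=> <-; rewrite ler_pdivrMr// ltr_pdivlMr// mulrC floor_le/=.
  by rewrite floorD1_gt.
by rewrite ler_pdivrMr// ltr_pdivlMr// mulrC => h; apply/floor_def.
Qed.

Lemma measurable_dyadic j k : measurable (dyadic j k).
Proof. by rewrite dyadicE; exact: measurable_itv. Qed.

Lemma leb_dyadic j k : leb (dyadic j k) = ((2 ^+ j)^-1)%:E.
Proof.
have p0 : 0 < 2 ^+ j :> R by rewrite exprn_gt0.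
rewrite dyadicE /leb lebesgue_measure_itv/= lte_fin ltr_pM2r ?invr_gt0// ltr_int.
by rewrite ltzD1 lexx -EFinD -mulrBl -rmorphB/= addrAC subrr add0r mul1r.
Qed.

Lemma dyadic_floorS j x : (dyadic_floor j.+1 x %/ 2)%Z = dyadic_floor j x.
Proof.
rewrite /dyadic_floor exprS -mulrA.
set y := _ * x.
have /andP[h1 h2] := floor_itv y; have /andP[h3 h4] := floor_itv (2 * y).
have a1 : (2 * Num.floor y)%:~R < (Num.floor (2 * y) + 1)%:~R :> R.
  by rewrite (le_lt_trans _ h4)// intrM ler_pM2l.
have a2 : (Num.floor (2 * y))%:~R < (2 * (Num.floor y + 1))%:~R :> R.
  by rewrite (le_lt_trans h3)// intrM ltr_pM2l.
rewrite !ltr_int in a1 a2.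
lia.
Qed.

(* Off the dyadic points the closed supports of one level do not overlap. *)
Definition nondyadic J x : Prop := forall j, (j <= J)%N -> 2 ^+ j * x != (dyadic_floor j x)%:~R.

Definition position i x : int := dyadic_floor i.-1 x.

Lemma floor_unit (y : R) k : y != (Num.floor y)%:~R -> 0 <= y - k%:~R <= 1 -> k = Num.floor y.
Proof.
move=> yN /andP[h1 h2]; apply/esym/floor_def.
have {}h1 : k%:~R <= y by lra.
rewrite h1 /= lt_neqAle intrD; apply/andP; split; last by rewrite -[1%:~R]/1; lra.
apply: contraNneq yN => yE; rewrite {2}yE -[1%:~R]/((1%:Z)%:~R) -intrD intrKfloor yE.
by rewrite intrD.
Qed.

Lemma varphiSE j k x :
  varphi (haar_index j.+1 k) x = amplitude j.+1 * haar_psi (2 ^+ j * x - k%:~R).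
Proof. by []. Qed.

Lemma varphi_off i k x : nondyadic i.-1 x -> k <> position i x ->
  varphi (haar_index i k) x = 0.
Proof.
move=> nd kp; case: i nd kp => [|j] nd kp.
  rewrite /varphi/= /haar_phi; case: ifPn => // h; exfalso; apply: kp.
  have := nd 0%N (leqnn _); rewrite /position/= /dyadic_floor expr0 mul1r => xN.
  exact: floor_unit.
rewrite varphiSE /haar_psi; case: ifPn => [/andP[h1 h2]|_].
  by exfalso; apply: kp; apply: floor_unit; [exact: (nd j)|lra].
case: ifPn => [/andP[h1 h2]|_]; last by rewrite mulr0.
by exfalso; apply: kp; apply: floor_unit; [exact: (nd j)|lra].
Qed.

Lemma varphi_position0 x : varphi (haar_index 0 (position 0 x)) x = 1.
Proof.
rewrite /varphi/= /haar_phi /position/= /dyadic_floor expr0 mul1r.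
have /andP[h1 h2] := floor_itv x; rewrite intrD -[1%:~R]/1 in h2.
by rewrite ifT//; lra.
Qed.

Lemma varphi_positionS j x : nondyadic j.+1 x ->
  varphi (haar_index j.+1 (position j.+1 x)) x =
  (if (dyadic_floor j.+1 x %% 2)%Z == 0 then 1 else -1) * amplitude j.+1.
Proof.
move=> nd; rewrite varphiSE mulrC; congr (_ * _); rewrite /position/=.
have /andP[h1 h2] := floor_itv (2 ^+ j * x); rewrite intrD -[1%:~R]/1 in h2.
have q2 := dyadic_floorS j x; have nd' := nd j.+1 (leqnn _).
have /andP[h3 h4] := floor_itv (2 ^+ j.+1 * x); rewrite intrD -[1%:~R]/1 in h4.
rewrite -/(dyadic_floor j.+1 x) in h3 h4; rewrite -/(dyadic_floor j x) in h1 h2.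
have := divz_eq (dyadic_floor j.+1 x) 2; rewrite q2.
set q := dyadic_floor j x in h1 h2 *; set t := dyadic_floor j.+1 x in nd' h3 h4 *.
set y := 2 ^+ j * x in h1 h2 *; have yE : 2 ^+ j.+1 * x = 2 * y by rewrite /y mulrA -exprS.
rewrite yE in nd' h3 h4 => tE; rewrite /haar_psi.
have [/eqP r0|r0] := boolP ((t %% 2)%Z == 0).
  have {}tE : t%:~R = 2 * q%:~R :> R by rewrite tE r0 addr0 intrM mulrC.
  by rewrite ifT//; lra.
have {}tE : t%:~R = 2 * q%:~R + 1 :> R.
  have -> : t = 2 * q + 1 by lia.
  by rewrite intrD intrM.
(* The midpoint belongs to the positive half, but it is dyadic and hence excluded. *)
have lt3 : t%:~R < 2 * y by rewrite lt_neqAle eq_sym nd'.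
rewrite ifF; last by apply/negbTE; rewrite negb_and -!ltNge; apply/orP; right; lra.
by rewrite ifT//; apply/andP; split; lra.
Qed.

Lemma haar_expansion (c : nat -> int -> R) J x : nondyadic J x ->
  \sum_(i < J.+1) c i (position i x) * varphi (haar_index i (position i x)) x =
  haar_value c J (dyadic_floor J x).
Proof.
elim: J => [|J IH] nd; first by rewrite big_ord1 varphi_position0 mulr1.
rewrite big_ord_recr IH; last by move=> j jJ; apply: nd; rewrite leqW.
rewrite -[LHS]/(haar_value c J (dyadic_floor J x) + c J.+1 (position J.+1 x) *
  varphi (haar_index J.+1 (position J.+1 x)) x) varphi_positionS//.
by rewrite [RHS]/= dyadic_floorS [c _ _ * _]mulrC.
Qed.

(** At a nondyadic point at most one function per level is nonzero, which reduces the sum over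
    infinitely many shifts to [haar_expansion]. *)
Lemma fsbig_Gamma_varphi n (d : int * int -> R) x : nondyadic (j0 n).+1 x ->
  \sum_(l \in Gamma n) d l * varphi l x =
  haar_value (fun i k => d (haar_index i k)) (j0 n).+1 (dyadic_floor (j0 n).+1 x).
Proof.
move=> nd; rewrite -haar_expansion// (fsbig_ord _ _ (fun i =>
  d (haar_index i (position i x)) * varphi (haar_index i (position i x)) x)).
rewrite -(@fsbig_image _ _ _ _ _ `I_(j0 n).+2 (fun i => haar_index i (position i x))
   (fun l => d l * varphi l x)); last by move=> i i' _ _ /haar_index_inj[].
apply/esym/fsbig_widen; rewrite GammaE.
  by move=> _ [i iJ <-]; exists i => //; exists (position i x).
move=> _ [[i iJ [k _ <-]]] /= H; rewrite varphi_off ?mulr0//.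
  by move=> j ji; apply: nd; move: iJ => /=; lia.
by move=> kE; apply: H; exists i => //; rewrite kE.
Qed.

End HaarIndices.

(** * Haar coefficients as differences of dyadic integrals *)

Section HaarIntegrals.
Context {R : realType}.
Implicit Types (i j J : nat) (k : int) (x : R).

Definition haar_pos i k : set R := [set x | 0 < varphi (haar_index i k) x].
Definition haar_neg i k : set R := [set x | varphi (haar_index i k) x < 0].

Definition dyadic_point j k : R := k%:~R / 2 ^+ j.

Lemma haar_pos0E k : haar_pos 0 k = `[dyadic_point 0 k, dyadic_point 0 (k + 1)]%classic.
Proof.
rewrite /dyadic_point expr0 invr1 !mulr1; apply/seteqP; split => x /=.
all: rewrite /haar_pos/= /varphi/= /haar_phi in_itv/= intrD -[1%:~R]/1.
  by case: ifPn; rewrite ?ltxx// => /andP[h1 h2] _; apply/andP; split; lra.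
by move=> /andP[h1 h2]; rewrite ifT//; apply/andP; split; lra.
Qed.

Lemma haar_neg0E k : haar_neg 0 k = set0.
Proof.
apply/seteqP; split => x //=; rewrite /haar_neg/= /varphi/= /haar_phi.
by case: ifP; rewrite ?ltxx// ltr10.
Qed.

Lemma amplitudeS_gt0 j : 0 < amplitude j.+1 :> R.
Proof. by rewrite sqrtr_gt0 exprn_gt0. Qed.

Lemma amplitude_gt0 i : 0 < amplitude i :> R.
Proof. by case: i => [|j]; [exact: ltr01|exact: amplitudeS_gt0]. Qed.

Lemma haar_psi_gt0 (y : R) : (0 < haar_psi y) = (0 <= y <= 2^-1).
Proof. by rewrite /haar_psi; case: ifP => _; [rewrite ltr01|case: ifP; rewrite ?ltr0N1 ?ltxx]. Qed.

Lemma haar_psi_lt0 (y : R) : (haar_psi y < 0) = (2^-1 < y <= 1).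
Proof.
rewrite /haar_psi; case: ifPn => [/andP[h1 h2]|_]; last by case: ifP; rewrite ?ltrN10 ?ltxx.
by rewrite ltr10; apply/esym/negbTE; rewrite negb_and -leNgt h2.
Qed.

Lemma haar_posSE j k : haar_pos j.+1 k =
  `[dyadic_point j.+1 (2 * k), dyadic_point j.+1 (2 * k + 1)]%classic.
Proof.
have p0 : 0 < 2 ^+ j :> R by rewrite exprn_gt0.
apply/seteqP; split => x /=; rewrite /haar_pos/= varphiSE pmulr_rgt0 ?amplitudeS_gt0//.
all: rewrite haar_psi_gt0 in_itv/= /dyadic_point exprS ler_pdivrMr ?ler_pdivlMr ?mulr_gt0//.
all: rewrite intrD intrM -[2%:~R]/2 -[1%:~R]/1 => /andP[h1 h2].
all: by apply/andP; split; lra.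
Qed.

Lemma haar_negSE j k : haar_neg j.+1 k =
  `]dyadic_point j.+1 (2 * k + 1), dyadic_point j.+1 (2 * k + 1 + 1)]%classic.
Proof.
have p0 : 0 < 2 ^+ j :> R by rewrite exprn_gt0.
apply/seteqP; split => x /=; rewrite /haar_neg/= varphiSE pmulr_rlt0 ?amplitudeS_gt0//.
all: rewrite haar_psi_lt0 in_itv/= /dyadic_point exprS ltr_pdivrMr ?ler_pdivlMr ?mulr_gt0//.
all: rewrite !intrD intrM -[2%:~R]/2 -[1%:~R]/1 => /andP[h1 h2].
all: by apply/andP; split; lra.
Qed.

Lemma measurable_haar_pos i k : measurable (haar_pos i k).
Proof. by case: i => [|j]; rewrite ?haar_pos0E ?haar_posSE; exact: measurable_itv. Qed.

Lemma measurable_haar_neg i k : measurable (haar_neg i k).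
Proof. by case: i => [|j]; rewrite ?haar_neg0E ?haar_negSE//; exact: measurable_itv. Qed.

Lemma haar_pos_neg_disj i k : haar_pos i k `&` haar_neg i k = set0.
Proof. by apply/seteqP; split => x //= [h1 h2]; have := lt_trans h1 h2; rewrite ltxx. Qed.

Lemma haar_supportE i k : [set x | varphi (haar_index i k) x != 0] = haar_pos i k `|` haar_neg i k.
Proof.
apply/seteqP; split => x /=; rewrite /haar_pos /haar_neg /=.
  by rewrite neq_lt => /orP[h|h]; [right|left].
by case=> [/gt_eqF ->|/lt_eqF ->].
Qed.

Lemma varphi_indic i k x : varphi (haar_index i k) x =
  amplitude i * (\1_(haar_pos i k) x - \1_(haar_neg i k) x).
Proof.
rewrite !indicE; have [h|h|h] := ltgtP (varphi (haar_index i k) x) 0.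
- rewrite [_ \in haar_pos _ _]memNset ?[_ \in haar_neg _ _]mem_set//=; last first.
    by move=> h'; have := lt_trans h h'; rewrite ltxx.
  case: i h => [|j]; first by rewrite /varphi/= /haar_phi; case: ifP; rewrite ?ltxx ?ltr10.
  rewrite varphiSE pmulr_rlt0 ?amplitudeS_gt0// haar_psi_lt0 => h; congr (_ * _).
  rewrite /haar_psi h ifF ?sub0r//; apply/negbTE; rewrite negb_and -[X in _ || X]ltNge.
  by case/andP: h => ->; rewrite orbT.
- rewrite [_ \in haar_pos _ _]mem_set ?[_ \in haar_neg _ _]memNset//=; last first.
    by move=> h'; have := lt_trans h h'; rewrite ltxx.
  case: i h => [|j]; first by rewrite /varphi/= /haar_phi; case: ifP; rewrite ?ltxx// mul1r subr0.
  rewrite varphiSE pmulr_rgt0 ?amplitudeS_gt0// haar_psi_gt0 => h; congr (_ * _).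
  by rewrite /haar_psi h subr0.
- rewrite ![_ \in _]memNset/= ?subrr ?mulr0//; rewrite /haar_pos /haar_neg/= h ltxx//.
Qed.

Variable f : R -> R.
Hypothesis f_int : leb.-integrable setT (EFin \o f).

Lemma integrable_sub (A : set R) : measurable A -> leb.-integrable A (EFin \o f).
Proof. by move=> mA; apply: integrableS f_int. Qed.

Definition dyadic_integral j k : R := Rintegral leb (dyadic j k) f.

(** The set [haar_pos] is closed and [dyadic] half-open; they differ by an endpoint, which is a null
    set. *)
Lemma Rintegral_haar_pos i k : Rintegral leb (haar_pos i k) f =
  if i is j.+1 then dyadic_integral j.+1 (2 * k) else dyadic_integral 0 k.
Proof.
case: i => [|j]; rewrite /dyadic_integral dyadicE ?haar_pos0E ?haar_posSE.
all: by rewrite -Rintegral_itv_bndo_bndc//; apply: integrable_sub; exact: measurable_itv.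
Qed.

Lemma Rintegral_haar_neg i k : Rintegral leb (haar_neg i k) f =
  if i is j.+1 then dyadic_integral j.+1 (2 * k + 1) else 0.
Proof.
case: i => [|j]; first by rewrite haar_neg0E Rintegral_set0.
rewrite /dyadic_integral dyadicE haar_negSE Rintegral_itv_obnd_cbnd; last first.
  by apply: integrable_sub; exact: measurable_itv.
by rewrite -Rintegral_itv_bndo_bndc//; apply: integrable_sub; exact: measurable_itv.
Qed.

Lemma dyadicS j k : dyadic j k = dyadic j.+1 (2 * k) `|` dyadic j.+1 (2 * k + 1) :> set R.
Proof.
apply/seteqP; split => x; rewrite /dyadic/= -(dyadic_floorS j x).
  set t := dyadic_floor j.+1 x => tE.
  by have [->|->] : t = 2 * k \/ t = 2 * k + 1; [lia|left|right].
by case=> ->; lia.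
Qed.

Lemma dyadic_integralS j k :
  dyadic_integral j k = dyadic_integral j.+1 (2 * k) + dyadic_integral j.+1 (2 * k + 1).
Proof.
rewrite /dyadic_integral dyadicS Rintegral_setU//; try exact: measurable_dyadic.
- by apply: integrable_sub; apply: measurableU; exact: measurable_dyadic.
- by apply/disj_setPS => x; rewrite /dyadic/= => -[/= -> /eqP]; lia.
Qed.

Lemma betaE i k : beta f (haar_index i k) =
  amplitude i * (Rintegral leb (haar_pos i k) f - Rintegral leb (haar_neg i k) f).
Proof.
rewrite /beta.
have mp := measurable_haar_pos i k; have mn := measurable_haar_neg i k.
transitivity (Rintegral leb setT
    (fun x => amplitude i * ((f \_ (haar_pos i k)) x - (f \_ (haar_neg i k)) x))).
  apply: eq_Rintegral => x _; rewrite varphi_indic -mulrA; congr (_ * _).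
  by rewrite mulrBl !patchE !indicE; case: ifP; case: ifP; rewrite ?mul1r ?mul0r.
have int_patch (A : set R) : measurable A -> leb.-integrable setT (EFin \o (f \_ A)).
  move=> mA; rewrite -restrict_EFin; apply/integrable_restrict => //.
  by rewrite setTI; exact: integrable_sub.
rewrite RintegralZl//; last exact: (integrableB measurableT (int_patch _ mp) (int_patch _ mn)).
rewrite RintegralB//; [|exact: int_patch..].
by rewrite -!Rintegral_mkcond.
Qed.

Lemma bigFE i k : bigF f (haar_index i k) =
  Rintegral leb (haar_pos i k) f + Rintegral leb (haar_neg i k) f.
Proof.
have mp := measurable_haar_pos i k; have mn := measurable_haar_neg i k.
rewrite /bigF haar_supportE Rintegral_setU//.
- by apply: integrable_sub; exact: measurableU.
- by apply/disj_setPS; rewrite haar_pos_neg_disj.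
Qed.

Lemma bigF_dyadic i k : bigF f (haar_index i k) = dyadic_integral i.-1 k.
Proof.
rewrite bigFE Rintegral_haar_pos Rintegral_haar_neg; case: i => [|j]; first by rewrite addr0.
by rewrite -dyadic_integralS.
Qed.

Lemma VE n i k : V n f (haar_index i k) = n%:R^-1 * (amplitude i ^+ 2 * bigF f (haar_index i k)).
Proof.
have mp := measurable_haar_pos i k; have mn := measurable_haar_neg i k.
rewrite /V /bigF haar_supportE; congr (_ * _); rewrite [in RHS]Rintegral_mkcond -RintegralZl//.
  apply: eq_Rintegral => x _; rewrite varphi_indic exprMn -mulrA; congr (_ * _).
  rewrite patchE !indicE in_setU.
  have := haar_pos_neg_disj i k => /seteqP[/(_ x)/= dis _].
  case: (boolP (x \in haar_pos i k)) => [/set_mem xp|_];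
    case: (boolP (x \in haar_neg i k)) => [/set_mem xn|_] //=.
  - by exfalso; exact: dis.
  - by rewrite subr0 expr1n mul1r.
  - by rewrite sub0r sqrrN expr1n mul1r.
  - by rewrite subrr expr0n/= mul0r.
rewrite -restrict_EFin; apply/integrable_restrict => //; first exact: measurableU.
by rewrite setTI; apply: integrable_sub; exact: measurableU.
Qed.

(** Induction on [J]: the mean of [f] over a half interval is its mean over the parent, plus or
    minus [2^J] times the difference of the integrals over the halves. *)
Lemma haar_value_beta J k :
  haar_value (fun i k => beta f (haar_index i k)) J k = 2 ^+ J * dyadic_integral J k.
Proof.
elim: J k => [|J IH] k.
  by rewrite /= betaE Rintegral_haar_pos Rintegral_haar_neg subr0 expr0.
rewrite [LHS]/= IH betaE Rintegral_haar_pos Rintegral_haar_neg dyadic_integralS.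
set q := (k %/ 2)%Z; have kE := divz_eq k 2; rewrite -/q in kE.
have := amplitude_sqr (R := R) J; rewrite /=; set s := Num.sqrt _ => s2.
rewrite exprS -s2; have [/eqP r0|r0] := boolP ((k %% 2)%Z == 0).
  by have -> : k = 2 * q by [lia]; ring.
by have -> : k = 2 * q + 1 by [lia]; ring.
Qed.

End HaarIntegrals.

(** * Almost everywhere expansion and the integrated loss *)

Section HaarLoss.
Context {R : realType}.
Implicit Types (i j J : nat) (k : int) (x : R).

Lemma haar_value_stable (c : nat -> int -> R) J m x : (J <= m)%N ->
  (forall i k, (J < i)%N -> c i k = 0) ->
  haar_value c m (dyadic_floor m x) = haar_value c J (dyadic_floor J x).
Proof.
move=> /subnK <- c0; elim: (m - J)%N => [|p IH] //.
by rewrite addSn [LHS]/= dyadic_floorS c0 ?mulr0 ?addr0 ?IH// ltnS leq_addl.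
Qed.

Lemma dyadic_nicely_shrinking x :
  nicely_shrinking x (fun m => dyadic m (dyadic_floor m x)).
Proof.
split => [m|]; first exact: measurable_dyadic.
have p0 m : 0 < 2 * (2 ^+ m)^-1 :> R by rewrite mulr_gt0// invr_gt0 exprn_gt0.
(* The ball of radius [2 * 2^-m] about [x] contains the dyadic interval of [x], and its measure
   [4 * 2^-m] is 4 times that of the interval. *)
exists (4, fun m => PosNum (p0 m)); split => //=.
- have : `|2^-1 : R| < 1 by rewrite ger0_norm ?invr_ge0// invf_lt1 ?ltr1n.
  move=> /(@cvg_geometric R 2); apply: cvg_trans; apply: near_eq_cvg.
  by near=> m; rewrite /geometric/= exprVn.
- move=> m y /= yE; rewrite -ball_normE/=.
  have q0 : 0 < 2 ^+ m :> R by rewrite exprn_gt0.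
  have /andP[h1 h2] := floor_itv (2 ^+ m * x); have /andP[h3 h4] := floor_itv (2 ^+ m * y).
  rewrite -[Num.floor (2 ^+ m * y)]/(dyadic_floor m y) yE in h3 h4.
  rewrite intrD -[1%:~R]/1 in h2; rewrite intrD -[1%:~R]/1 in h4.
  rewrite -(ltr_pM2l q0) -[X in X * `|_|]gtr0_norm// -normrM mulrBr.
  rewrite mulrCA divff ?gt_eqF// mulr1.
  rewrite -[Num.floor (2 ^+ m * x)]/(dyadic_floor m x) in h1 h2.
  by rewrite ltr_norml; apply/andP; split; lra.
- move=> m; rewrite lebesgue_measure_ball; last exact: ltW.
  rewrite -[lebesgue_measure (dyadic _ _)]/(leb (dyadic m (dyadic_floor m x))) leb_dyadic.
  by rewrite -EFinM lee_fin; lra.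
Unshelve. all: by end_near. Qed.

Lemma nondyadic_ae J : \forall x \ae leb, @nondyadic R J x.
Proof.
have cnt : countable (range (fun p : nat * int => dyadic_point p.1 p.2 : R)).
  exact: card_le_trans (card_image_le _ _) (countableP _).
exists (range (fun p : nat * int => dyadic_point p.1 p.2)); split.
- exact: countable_measurable.
- exact: countable_lebesgue_measure0.
- move=> x /= /existsNP[j /not_implyP[jJ /negP]]; rewrite negbK => /eqP xE.
  exists (j, dyadic_floor j x) => //=; rewrite /dyadic_point -xE mulrAC divff ?mul1r//.
Qed.

(** At a Lebesgue point [x] the means of [f] over the dyadic intervals around [x] converge to [f x];
    beyond level [J], where the coefficients vanish, these means no longer change. *)
Lemma haar_value_ae (f : R -> R) J : leb.-integrable setT (EFin \o f) ->
  (forall i k, (J < i)%N -> beta f (haar_index i k) = 0) ->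
  \forall x \ae leb, f x = haar_value (fun i k => beta f (haar_index i k)) J (dyadic_floor J x).
Proof.
move=> intf beta0.
have floc : locally_integrable setT f by apply: open_integrable_locally => //; exact: openT.
apply: (@filterS _ _ (ae_filter_ringOfSetsType (@leb R)) _ _ _
  (lebesgue_differentiation floc)) => x xL.
have := nice_lebesgue_differentiation dyadic_nicely_shrinking floc xL.
set v := haar_value _ _ _.
have cv : ((lebesgue_measure (dyadic m (dyadic_floor m x)))^-1 *
    \int[lebesgue_measure]_(y in dyadic m (dyadic_floor m x)) (f y)%:E)%E @[m --> \oo]
    --> v%:E.
  apply: cvg_near_cst; exists J => // m /= Jm.
  rewrite -[lebesgue_measure (dyadic _ _)]/(leb (dyadic m (dyadic_floor m x))) leb_dyadic.
  rewrite inver invr_eq0 gt_eqF ?exprn_gt0// invrK.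
  have mD := @measurable_dyadic R m (dyadic_floor m x).
  have : (\int[leb]_(y in dyadic m (dyadic_floor m x)) (f y)%:E)%E \is a fin_num.
    exact: (@integrable_fin_num _ _ _ (@leb R) _ mD _ (integrable_sub intf mD)).
  move=> /fineK /= <-; rewrite -EFinM; congr (_%:E).
  by rewrite /v -(haar_value_stable x Jm)// haar_value_beta.
by move=> /(cvg_unique _) -/(_ (@ereal_hausdorff R) _ cv) [].
Qed.

Lemma haar_loss n (f : R -> R) (d : int * int -> R) :
  leb.-integrable setT (EFin \o f) ->
  (forall i k, ((j0 n).+1 < i)%N -> beta f (haar_index i k) = 0) ->
  (\int[leb]_x ((\sum_(l \in Gamma n) d l * varphi l x - f x) ^+ 2)%:E <=
   \esum_(l in Gamma n) ((d l - beta f l) ^+ 2)%:E)%E.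
Proof.
move=> intf beta0; set J := (j0 n).+1.
pose c i k := d (haar_index i k) - beta f (haar_index i k).
(* The squared error is a sum of multiples of indicators of dyadic intervals, and its integral is
   the energy computed by [haar_energy]. *)
pose a k x := (cst (haar_value c J k ^+ 2)%:E \_ (dyadic J k)) x.
have a0 k x : (0 <= a k x)%E by rewrite /a patchE; case: ifP => // _; rewrite lee_fin sqr_ge0.
have ma k : measurable_fun setT (a k).
  by apply/(measurable_restrictT _ (measurable_dyadic J k)); exact: measurable_cst.
pose S x := \esum_(k in setT) a k x.
have S0 x : (0 <= S x)%E by exact: esum_ge0.
have mS : measurable_fun setT S by exact: measurable_esum.
have SE x : S x = (haar_value c J (dyadic_floor J x) ^+ 2)%:E.
  rewrite /S (@esum_eq1 _ _ (dyadic_floor J x))//.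
    by rewrite /a patchT// inE.
  by move=> k kx; rewrite /a patchN// notin_setE => /esym.
have [N [mN N0 subN]] : leb.-negligible (~` [set x |
    ((\sum_(l \in Gamma n) d l * varphi l x - f x) ^+ 2)%:E = S x]).
  apply: (@filterS2 _ _ (ae_filter_ringOfSetsType (@leb R)) _ _ _ _
    (nondyadic_ae J) (haar_value_ae intf beta0)) => x nd fx /=.
  by rewrite SE fsbig_Gamma_varphi// fx -haar_valueB.
(* Adding [+oo] on the null set [N] turns the almost everywhere identity into a pointwise
   bound by a measurable function. *)
apply: (@le_trans _ _ (\int[leb]_x (S x + (cst +oo%E \_ N) x))%E).
  apply: le_integral_nneg => x; first by rewrite lee_fin sqr_ge0.
  have [xN|xN] := pselect (N x); last first.
    rewrite [X in (_ + X)%E]patchN ?notin_setE// adde0.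
    by rewrite le_eqVlt; apply/orP; left; apply/eqP; apply: contrapT => h; exact/xN/subN.
  by rewrite patchT ?inE// addey ?leey// gt_eqF// (lt_le_trans _ (S0 x))// ltNyr.
rewrite ge0_integralD//; last 2 first.
- by move=> x _; rewrite patchE; case: ifP => _ //; rewrite leey.
- by apply/(measurable_restrictT _ mN); exact: measurable_cst.
have -> : (\int[leb]_x (cst +oo \_ N) x)%E = 0%E.
  rewrite -integral_mkcond integral_cst// -[RHS](mule0 +oo%E).
  by congr (_ * _)%E; exact: N0.
rewrite adde0.
rewrite /S integral_esum// esum_Gamma; last by move=> l; rewrite lee_fin sqr_ge0.
rewrite -(haar_energy c); apply: le_esum => k _.
rewrite -integral_mkcond integral_cst; last exact: measurable_dyadic.
have -> : ((2 ^+ J)^-1 * haar_value c J k ^+ 2)%:E =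
    ((haar_value c J k ^+ 2)%:E * ((2 ^+ J)^-1)%:E)%E by rewrite -EFinM mulrC.
rewrite le_eqVlt; apply/orP; left; apply/eqP.
by congr (_ * _)%E; exact: leb_dyadic.
Qed.

End HaarLoss.

(** * Law of the pair of counts on two disjoint sets *)

Section PoissonCounts.
Context {R : realType} d (Omega : measurableType d) (P : probability Omega R).
Variables (N : Omega -> seq R) (g : R -> R).
Hypothesis N_poisson : is_poisson_process P N g.
Variables A B : set R.
Hypotheses (mA : measurable A) (mB : measurable B) (AB0 : A `&` B = set0).

Let counts w : nat * nat := (npoints (N w) A, npoints (N w) B).
Let fiber (t : nat * nat) : set Omega := [set w | counts w = t].

Lemma measurable_fiber t : measurable (fiber t).
Proof.
have [mN _] := N_poisson.
rewrite (_ : fiber t = [set w | npoints (N w) A = t.1] `&` [set w | npoints (N w) B = t.2]).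
  by apply: measurableI; exact: mN.
apply/seteqP; split => w; rewrite /fiber/=; first by move=> <-.
by case: t => k l /= [<- <-].
Qed.

Lemma P_fiber k l :
  P (fiber (k, l)) = (poisson_p (Rintegral leb A g) k * poisson_p (Rintegral leb B g) l)%:E.
Proof.
have [_ Nind] := N_poisson.
pose AA (i : 'I_2) := if i == ord0 then A else B.
pose kk (i : 'I_2) := if i == ord0 then k else l.
have := Nind 2%N AA kk.
rewrite !big_ord_recl big_ord0 mulr1 /AA /kk/= => <-.
- congr (P _); apply/seteqP; split => w; rewrite /fiber/=.
    by case=> <- <- i; case: ifP.
  by move=> h; rewrite /counts; have := h ord0; have := h (lift ord0 ord0) => /= -> ->.
- by move=> i; case: ifP.
- move=> i j ij; case: ifPn => [/eqP i0|i0]; case: ifPn => [/eqP j0|j0] //.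
  + by rewrite i0 j0 eqxx in ij.
  + by rewrite setIC.
  + case/negP: ij; apply/eqP/val_inj => /=.
    by move: i0 j0; rewrite -!val_eqE/=; case: i j => [[|[|i]] ?] [[|[|j]] ?].
Qed.

Lemma esum_diagonals (a : nat * nat -> \bar R) : (forall t, 0 <= a t)%E ->
  \esum_(t in setT) a t = (\sum_(0 <= m <oo) \sum_(k < m.+1) a (nat_of_ord k, m - k)%N)%E.
Proof.
move=> a0; rewrite nneseries_esumT; last by move=> m; exact: sume_ge0.
rewrite (_ : setT = \bigcup_(m in setT) ((fun k => (k, m - k)%N) @` `I_m.+1)); last first.
  apply/seteqP; split => // -[k l] _; exists (k + l)%N => //; exists k => /=.
    by rewrite ltnS leq_addr.
  by rewrite addKn.
rewrite esum_bigcupT//; last first.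
  move=> m m' _ _ [_ [[k /= km <-] [k' /= km' [kk' mm']]]].
  by move: mm' km km'; rewrite kk'; lia.
apply: eq_esum => m _; rewrite esum_image; last by move=> k k' _ _ [].
by rewrite esum_fset// (fsbig_ord _ _ (fun k => a (k, m - k)%N)).
Qed.

Variable h : nat -> nat -> R.
Hypothesis h_ge0 : forall k l, 0 <= h k l.

(** A function of the counts is split according to their values, so that its integral only involves
    the probabilities of countably many fibers. *)
Let term (t : nat * nat) (w : Omega) : \bar R := (cst (h t.1 t.2)%:E \_ (fiber t)) w.

Let term_ge0 t w : (0 <= term t w)%E.
Proof. by rewrite /term patchE; case: ifP => // _; rewrite lee_fin. Qed.

Let measurable_term t : measurable_fun setT (term t).
Proof. by apply/(measurable_restrictT _ (measurable_fiber t)); exact: measurable_cst. Qed.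

Let counts_esum : (fun w => (h (npoints (N w) A) (npoints (N w) B))%:E) =
  (fun w => \esum_(t in setT) term t w).
Proof.
apply/funext => w; rewrite (@esum_eq1 _ _ (counts w))//.
  by rewrite /term patchT// inE.
by move=> t tw; rewrite /term patchN// notin_setE => /esym.
Qed.

Lemma measurable_counts :
  measurable_fun setT (fun w => (h (npoints (N w) A) (npoints (N w) B))%:E).
Proof. by rewrite counts_esum; exact: measurable_esum. Qed.

Lemma integral_counts :
  (\int[P]_w (h (npoints (N w) A) (npoints (N w) B))%:E)%E =
  poisson2E (Rintegral leb A g) (Rintegral leb B g) h.
Proof.
rewrite (_ : (fun w => _) = (fun w => \esum_(t in setT) term t w)); last exact: counts_esum.
rewrite integral_esum// esum_diagonals; last by move=> t; exact: integral_ge0.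
apply: eq_eseriesr => m _; rewrite -sumEFin; apply: eq_bigr => k _.
rewrite -integral_mkcond integral_cst; last exact: measurable_fiber.
by rewrite mulrC EFinM; congr (_ * _)%E; exact: P_fiber.
Qed.

End PoissonCounts.

(** * Rescaling the estimator to counts *)

Section Scaling.
Context {R : realType}.
Implicit Types (i : nat) (k : int) (s : seq R).

Lemma sum_indic s (A : set R) : \sum_(t <- s) (\1_A t : R) = (npoints s A)%:R.
Proof.
elim: s => [|t s IH]; first by rewrite big_nil.
by rewrite big_cons IH /npoints/= natrD indicE.
Qed.

Lemma beta_hatE n s i k : beta_hat n s (haar_index i k) =
  amplitude i / n%:R * ((npoints s (haar_pos i k))%:R - (npoints s (haar_neg i k))%:R).
Proof.
rewrite /beta_hat; under eq_bigr do rewrite varphi_indic.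
by rewrite -mulr_sumr sumrB !sum_indic mulrA [_^-1 * _]mulrC.
Qed.

Lemma varphi_sqr i k (x : R) : varphi (haar_index i k) x ^+ 2 =
  amplitude i ^+ 2 * (\1_(haar_pos i k) x + \1_(haar_neg i k) x).
Proof.
rewrite varphi_indic exprMn; congr (_ * _); rewrite !indicE.
have := haar_pos_neg_disj (R := R) i k => /seteqP[/(_ x)/= dis _].
case: (boolP (x \in haar_pos i k)) => [/set_mem xp|_];
  case: (boolP (x \in haar_neg i k)) => [/set_mem xn|_] /=; last first.
- by rewrite subr0 addr0 expr0n.
- by rewrite sub0r add0r sqrrN expr1n.
- by rewrite subr0 addr0 expr1n.
- by exfalso; exact: dis.
Qed.

Lemma V_hatE n s i k : V_hat n s (haar_index i k) =
  (amplitude i / n%:R) ^+ 2 * (npoints s (haar_pos i k) + npoints s (haar_neg i k))%:R.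
Proof.
rewrite /V_hat; under eq_bigr do rewrite varphi_sqr.
by rewrite -mulr_sumr big_split/= !sum_indic natrD mulrA [_^-1 * _]mulrC expr_div_n.
Qed.

Lemma leb_haar_pos_gt0 i k : (0 < leb (@haar_pos R i k))%E.
Proof.
have p0 j : 0 < 2 ^+ j :> R by rewrite exprn_gt0.
have lt_point j (a : int) : dyadic_point j a < dyadic_point j (a + 1) :> R.
  by rewrite /dyadic_point ltr_pM2r ?invr_gt0// ltr_int; lia.
case: i => [|j]; rewrite ?haar_pos0E ?haar_posSE /leb lebesgue_measure_itv/= lte_fin lt_point.
all: by rewrite -EFinD lte_fin subr_gt0.
Qed.

(** An essential supremum below the amplitude would put [haar_pos], which has positive measure,
    inside a null set. *)
Lemma varphi_supE i k : varphi_sup (haar_index i k) = amplitude i :> R.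
Proof.
rewrite /varphi_sup unlock.
have lp := leb_haar_pos_gt0 i k; have a0 := amplitude_gt0 (R := R) i.
have mp := measurable_haar_pos (R := R) i k.
have lT : (0 < @leb R setT)%E.
  by rewrite (lt_le_trans lp)//; apply: le_measure; rewrite ?inE.
rewrite lT (_ : ess_sup _ _ = (amplitude i)%:E)//.
apply/eqP; rewrite eq_le; apply/andP; split.
  apply: ess_sup_ler => x /=.
  rewrite varphi_indic !indicE lee_fin normrM gtr0_norm//; apply: ler_piMr; first exact: ltW.
  by case: (x \in _); case: (x \in _) => /=; rewrite ?subrr ?subr0 ?sub0r ?normrN ?normr0 ?normr1.
rewrite leNgt; apply/negP => lt_sup.
have := ess_sup_ge (@leb R) (abse \o (EFin \o varphi (haar_index i k))).
case=> N [mN N0 subN].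
have : haar_pos i k `<=` N.
  move=> x xp; apply: subN => /= le_x.
  have := le_lt_trans le_x lt_sup; rewrite lte_fin varphi_indic !indicE mem_set//=.
  rewrite memNset ?subr0 ?mulr1 ?gtr0_norm ?ltxx// => xn.
  by have : (haar_pos i k `&` haar_neg i k) x by []; rewrite haar_pos_neg_disj.
move=> /(le_measure leb); rewrite !inE => /(_ mp mN).
move=> /(lt_le_trans lp) N_gt0; suff : (0 < 0 :> \bar R)%E by rewrite ltxx.
by rewrite -[X in (_ < X)%E]N0; exact: N_gt0.
Qed.

(** Homogeneity: with [q] the amplitude over [n], both [V_hat] and the squared sup norm over [n^2]
    carry the factor [q^2], which leaves the outer square root as [q]. *)
Lemma etaE n g s i k : (0 < n)%N -> Defs.eta n g s (haar_index i k) =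
  amplitude i / n%:R * threshold g (ln n%:R)
    (npoints s (haar_pos i k) + npoints s (haar_neg i k)).
Proof.
move=> n0; rewrite /Defs.eta /V_tilde V_hatE varphi_supE /threshold.
have n0' : n%:R != 0 :> R by rewrite pnatr_eq0 -lt0n.
set m := (_ + _)%N; set L := ln _.
have q0 : 0 <= amplitude i / n%:R :> R by rewrite divr_ge0 ?amplitude_ge0.
rewrite -!expr_div_n; set q := amplitude i / n%:R in q0 *.
have -> : 2 * g * L * (q ^+ 2 * m%:R) * q ^+ 2 = (q ^+ 2) ^+ 2 * (2 * g * L * m%:R) by ring.
rewrite (sqrtrM _ (sqr_ge0 _)) sqrtr_sqr ger0_norm ?sqr_ge0//.
set r := Num.sqrt (2 * g * L * m%:R).
have -> : 2 * g * (q ^+ 2 * m%:R + q ^+ 2 * r + 3 * g * L * q ^+ 2) * L =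
   q ^+ 2 * (2 * g * (m%:R + r + 3 * g * L) * L) by ring.
rewrite (sqrtrM _ (sqr_ge0 _)) sqrtr_sqr ger0_norm// [RHS]mulrDr; congr (_ + _).
by rewrite /q; field; rewrite n0'.
Qed.

Lemma coefficient_loss n g s i k (f : R -> R) : (0 < n)%N ->
  leb.-integrable setT (EFin \o f) ->
  ((if Defs.eta n g s (haar_index i k) <= `|beta_hat n s (haar_index i k)|
    then beta_hat n s (haar_index i k) else 0) - beta f (haar_index i k)) ^+ 2 =
  (amplitude i / n%:R) ^+ 2 * threshold_loss g (ln n%:R)
     (n%:R * Rintegral leb (haar_pos i k) f - n%:R * Rintegral leb (haar_neg i k) f)
     (npoints s (haar_pos i k)) (npoints s (haar_neg i k)).
Proof.
move=> n0 intf; have n0' : 0 < n%:R :> R by rewrite ltr0n.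
rewrite etaE// beta_hatE betaE// /threshold_loss /kept.
have q0 : 0 < amplitude i / n%:R :> R by rewrite divr_gt0// amplitude_gt0.
have -> : amplitude i = amplitude i / n%:R * n%:R :> R by rewrite divfK// gt_eqF.
rewrite mulfK ?gt_eqF//; set q := amplitude i / n%:R in q0 *.
rewrite normrM (gtr0_norm q0) ler_pM2l// -exprMn; congr (_ ^+ 2).
by case: ifP => _; ring.
Qed.

End Scaling.

(** * Bounds valid on the function class *)

Section FunctionClass.
Context {R : realType} (n : nat) (Rad : R) (f : R -> R).
Hypothesis f_class : Fclass n Rad f.

Lemma Fclass_ge0 x : 0 <= f x.
Proof. by case: f_class => _ [+ _]; apply. Qed.

Lemma Fclass_integral_le : (\int[leb]_x (f x)%:E <= Rad%:E)%E.
Proof.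
case: f_class => _ [f0 [+ _]]; rewrite Lnorm1.
rewrite (_ : (fun x => `|(EFin \o f) x|%E) = (EFin \o f))//.
by apply/funext => x /=; rewrite ger0_norm.
Qed.

Lemma Fclass_integrable : leb.-integrable setT (EFin \o f).
Proof.
apply/integrableP; split.
  by apply/measurable_EFinP; case: f_class.
apply: le_lt_trans (ltry Rad); apply: le_trans Fclass_integral_le.
rewrite le_eqVlt; apply/orP; left; apply/eqP; apply: eq_integral => x _ /=.
by rewrite ger0_norm// Fclass_ge0.
Qed.

Lemma Fclass_ae_le : \forall x \ae leb, f x <= Rad.
Proof.
case: f_class => _ [f0 [_ [_ [+ _]]]]; rewrite unlock.
have lT : (0 < @leb R setT)%E.
  rewrite (lt_le_trans (leb_haar_pos_gt0 0 0))//; apply: le_measure; rewrite ?inE//.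
  exact: measurable_haar_pos.
rewrite lT => /ess_supP; apply: (@filterS _ _ (ae_filter_ringOfSetsType (@leb R))) => x /=.
by rewrite lee_fin ger0_norm.
Qed.

Lemma Fclass_radius_ge0 : 0 <= Rad.
Proof.
rewrite -lee_fin (le_trans _ Fclass_integral_le)//.
by apply: integral_ge0 => x _; rewrite lee_fin Fclass_ge0.
Qed.

Lemma dyadic_integral_ge0 j k : 0 <= dyadic_integral f j k.
Proof. by apply: Rintegral_ge0 => x _; exact: Fclass_ge0. Qed.

Lemma dyadic_integral_fin j k :
  (dyadic_integral f j k)%:E = (\int[leb]_(x in dyadic j k) (f x)%:E)%E.
Proof.
have mD := @measurable_dyadic R j k.
apply: fineK; exact: (@integrable_fin_num _ _ _ (@leb R) _ mD _
  (integrable_sub Fclass_integrable mD)).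
Qed.

Lemma dyadic_integral_le j k : dyadic_integral f j k <= Rad / 2 ^+ j.
Proof.
have mD := @measurable_dyadic R j k.
rewrite -lee_fin dyadic_integral_fin.
apply: (@le_trans _ _ (\int[leb]_(x in dyadic j k) cst Rad%:E x)%E); last first.
  rewrite integral_cst// EFinM le_eqVlt; apply/orP; left; apply/eqP.
  by congr (_ * _)%E; exact: leb_dyadic.
apply: (@ae_ge0_le_integral _ _ _ (@leb R)) => //.
- by move=> x _; rewrite lee_fin Fclass_ge0.
- by apply: measurable_funTS; apply/measurable_EFinP; case: f_class.
- by move=> x _; rewrite lee_fin Fclass_radius_ge0.
- apply: (@filterS _ _ (ae_filter_ringOfSetsType (@leb R)) _ _ _ Fclass_ae_le) => x fx _.
  by rewrite lee_fin.
Qed.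

Lemma esum_dyadic_integral j :
  (\esum_(k in setT) (dyadic_integral f j k)%:E <= Rad%:E)%E.
Proof.
apply: le_trans Fclass_integral_le.
rewrite (@integral_fibers _ _ _ (@leb R) _ (fun k => dyadic j k) (dyadic_floor j)) //.
- by apply: le_esum => k _; rewrite dyadic_integral_fin.
- by move=> x; rewrite lee_fin Fclass_ge0.
- by apply/measurable_EFinP; case: f_class.
- by move=> k; exact: measurable_dyadic.
Qed.

Lemma amplitude_bigF_le i k : amplitude i ^+ 2 * bigF f (haar_index i k) <= Rad.
Proof.
rewrite bigF_dyadic; last exact: Fclass_integrable.
have := dyadic_integral_le i.-1 k; have p0 : 0 < 2 ^+ i.-1 :> R by rewrite exprn_gt0.
rewrite ler_pdivlMr// mulrC; case: i p0 => [|j] /= p0; last by rewrite sqr_sqrtr// ltW.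
by rewrite expr0 expr1n.
Qed.

Lemma bigF_ge0 i k : 0 <= bigF f (haar_index i k).
Proof. by rewrite bigF_dyadic ?dyadic_integral_ge0//; exact: Fclass_integrable. Qed.

Lemma beta_neq0_bigF i k : beta f (haar_index i k) != 0 ->
  ln n%:R * ln (ln n%:R) / n%:R <= bigF f (haar_index i k).
Proof.
case: f_class => _ [_ [_ [_ [_ +]]]] => /(_ (haar_index i k)) h b0.
by move: h; rewrite b0 mulr1; apply; case: i {b0}.
Qed.

Hypothesis n_gt0 : (0 < n)%N.

Lemma pow_j0_le : (2 ^ j0 n <= n)%N.
Proof. exact: trunc_logP. Qed.

Lemma pow_j0_gt : (n < 2 ^ (j0 n).+1)%N.
Proof. exact: trunc_log_ltn. Qed.

Lemma amplitude_sqr_le i : (i < (j0 n).+2)%N -> amplitude i ^+ 2 <= n%:R :> R.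
Proof.
case: i => [|j] ij; first by rewrite expr1n ler1n.
rewrite amplitude_sqr -natrX ler_nat (leq_trans _ pow_j0_le)// leq_exp2l//.
Qed.

(** Index [i] means intervals of length [2^-(i-1)], here less than [1/n]; so [bigF] is at most
    [Rad / n], too small for a nonzero coefficient in the class. *)
Lemma Fclass_beta0 i k : Rad < ln n%:R * ln (ln n%:R) -> ((j0 n).+1 < i)%N ->
  beta f (haar_index i k) = 0.
Proof.
move=> RL ji; apply/eqP/negPn/negP => /beta_neq0_bigF.
have n0 : 0 < n%:R :> R by rewrite ltr0n.
rewrite bigF_dyadic; last exact: Fclass_integrable.
move=> /le_trans/(_ (dyadic_integral_le _ _)).
have R0 := Fclass_radius_ge0.
rewrite leNgt => /negP; apply.
apply: (@le_lt_trans _ _ (Rad / n%:R)); last by rewrite ltr_pM2r ?invr_gt0.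
rewrite ler_wpM2l// lef_pV2 ?posrE ?exprn_gt0// -natrX ler_nat.
by rewrite (leq_trans (ltnW pow_j0_gt))// leq_exp2l//; lia.
Qed.

End FunctionClass.

(** * Risk of each coefficient and its summation *)

Section OracleInequality.
Context {R : realType} (n : nat) (Rad : R) (f : R -> R).
Hypothesis f_class : Fclass n Rad f.
Context d (Omega : measurableType d) (P : probability Omega R) (N : Omega -> seq R).
Hypothesis N_poisson : is_poisson_process P N (fun x => n%:R * f x).

Local Notation L := (@ln R n%:R).
Local Notation gam := (1 + @Num.sqrt R 2).

(** Factor of [bigF] in the risk of one coefficient; [Rad + 1] bounds
    [amplitude^2 * bigF + amplitude^2 / n]. *)
Definition remainder_cst : R := 2 * small_risk_cst * expR (- (11 / 10 * L)) * (Rad + 1).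

Hypothesis n_gt0 : (0 < n)%N.
(** In turn, these conditions on [n] absorb the second-moment constants, turn the class condition
    into [1000 L <= n F], make the fine levels vanish and let [n^-0.1] beat the constants of the
    remainder. *)
Hypothesis L_ge : 20 * expR 1 <= L.
Hypothesis lnL_ge : 1000 <= ln L.
Hypothesis L_gt_Rad : Rad < L.
Hypothesis L_ge_cst : 10 * (small_risk_cst * (Rad + 1) * Rad) <= L.

Definition kept_coefficient s l : R :=
  if Defs.eta n gam s l <= `|beta_hat n s l| then beta_hat n s l else 0.

Let mean_pos i k : R := n%:R * Rintegral leb (haar_pos i k) f.
Let mean_neg i k : R := n%:R * Rintegral leb (haar_neg i k) f.

Definition scaled_loss i k a b : R :=
  (amplitude i / n%:R) ^+ 2 * threshold_loss gam L (mean_pos i k - mean_neg i k) a b.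

Lemma scaled_loss_ge0 i k a b : 0 <= scaled_loss i k a b.
Proof. by rewrite mulr_ge0 ?sqr_ge0// threshold_loss_ge0. Qed.

Lemma kept_coefficient_loss i k w :
  ((kept_coefficient (N w) (haar_index i k) - beta f (haar_index i k)) ^+ 2)%:E =
  (scaled_loss i k (npoints (N w) (haar_pos i k)) (npoints (N w) (haar_neg i k)))%:E.
Proof.
congr (_%:E); apply: coefficient_loss => //; exact: Fclass_integrable f_class.
Qed.

Lemma measurable_coefficient_loss i k : measurable_fun setT
  (fun w => ((kept_coefficient (N w) (haar_index i k) - beta f (haar_index i k)) ^+ 2)%:E).
Proof.
under eq_fun do rewrite kept_coefficient_loss.
exact: (measurable_counts N_poisson (measurable_haar_pos i k) (measurable_haar_neg i k)
  (scaled_loss_ge0 i k)).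
Qed.

Lemma coefficient_risk i k : (i < (j0 n).+2)%N ->
  (\int[P]_w ((kept_coefficient (N w) (haar_index i k) - beta f (haar_index i k)) ^+ 2)%:E <=
   (12 * L * Num.min (beta f (haar_index i k) ^+ 2) (V n f (haar_index i k)) +
    remainder_cst * bigF f (haar_index i k))%:E)%E.
Proof.
move=> iJ; have L_ge' := L_ge; have lnL_ge' := lnL_ge; have intf := Fclass_integrable f_class.
have n0 : 0 < n%:R :> R by rewrite ltr0n.
under eq_integral do rewrite kept_coefficient_loss.
rewrite (integral_counts N_poisson (measurable_haar_pos i k) (measurable_haar_neg i k)
  (haar_pos_neg_disj i k) (scaled_loss_ge0 i k)).
have intS (A : set R) : measurable A ->
    Rintegral leb A (fun x => n%:R * f x) = n%:R * Rintegral leb A f.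
  by move=> mA; rewrite RintegralZl//; exact: integrable_sub.
rewrite !intS; [|exact: measurable_haar_neg|exact: measurable_haar_pos].
have posE := Rintegral_haar_pos intf i k; have negE := Rintegral_haar_neg intf i k.
have x0 : 0 <= mean_pos i k.
  by rewrite mulr_ge0// posE; case: (i) => [|j]; apply: dyadic_integral_ge0 f_class _ _.
have y0 : 0 <= mean_neg i k.
  by rewrite mulr_ge0// negE; case: (i) => [|j] //; apply: dyadic_integral_ge0 f_class _ _.
rewrite -/(mean_pos i k) -/(mean_neg i k).
rewrite poisson2EZ//; last by move=> a b; exact: threshold_loss_ge0.
have FE : mean_pos i k + mean_neg i k = n%:R * bigF f (haar_index i k).
  by rewrite bigFE// mulrDr.
have bE : amplitude i / n%:R * (mean_pos i k - mean_neg i k) = beta f (haar_index i k).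
  by rewrite betaE// /mean_pos /mean_neg; field; rewrite gt_eqF.
(* A nonzero coefficient has [n F >= L ln L] by the class condition, and [ln L >= 1000]. *)
have far : mean_pos i k - mean_neg i k != 0 -> 1000 * L <= mean_pos i k + mean_neg i k.
  move=> b0; have : beta f (haar_index i k) != 0.
    by rewrite -bE mulf_neq0// gt_eqF// divr_gt0 ?amplitude_gt0.
  move=> /(beta_neq0_bigF f_class); rewrite ler_pdivrMr// FE [X in _ -> _ <= X]mulrC.
  apply: le_trans; rewrite [leLHS]mulrC ler_wpM2l//; have := expR_ge0 (1 : R); lra.
have risk := count_risk L_ge x0 y0 far.
have q0 : 0 <= (amplitude i / n%:R) ^+ 2 :> R by exact: sqr_ge0.
apply: (le_trans (lee_wpmul2l _ risk)); first by rewrite lee_fin.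
rewrite -EFinM lee_fin mulrDr lerD//.
  rewrite mulrCA minr_pMr// -exprMn bE VE// FE.
  rewrite (_ : _ * (n%:R * _) = n%:R^-1 * (amplitude i ^+ 2 * bigF f (haar_index i k)))//.
  by field; rewrite gt_eqF.
have ampF := amplitude_bigF_le f_class i k; have F0 := bigF_ge0 f_class i k.
have amp2 := amplitude_sqr_le (R := R) n_gt0 iJ.
rewrite FE; set F := bigF _ _ in ampF F0 *.
(* One factor [F] is kept for the sum over shifts; the rest is bounded through
   [amplitude^2 F <= Rad] and [amplitude^2 <= n]. *)
have -> : (amplitude i / n%:R) ^+ 2 * (2 * (small_risk_cst * (expR (- (11 / 10 * L)) *
    ((n%:R * F) ^+ 2 + n%:R * F)))) =
  2 * small_risk_cst * expR (- (11 / 10 * L)) *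
    ((amplitude i ^+ 2 * F + amplitude i ^+ 2 / n%:R) * F).
  by field; rewrite gt_eqF.
rewrite /remainder_cst -[leRHS]mulrA ler_wpM2l//.
  by rewrite !mulr_ge0 ?expR_ge0// addr_ge0 ?mulr_ge0 ?expR_ge0.
by rewrite ler_wpM2r// lerD// ler_pdivrMr// mul1r.
Qed.

Lemma log_level_le : (j0 n).+2%:R <= 4 * L.
Proof.
have n0 : 0 < n%:R :> R by rewrite ltr0n.
have L_ge' := L_ge; have lnL_ge' := lnL_ge; have L_ge_cst' := L_ge_cst.
have e0 := expR_ge1Dx (1 : R).
(* As [e <= 3], its square root is at most 2; hence [j0 n <= 2 L]. *)
have ln2 : 1 / 2 <= ln 2 :> R.
  rewrite -ler_expR lnK ?posrE//.
  have -> : expR (1 / 2) = Num.sqrt (expR 1) :> R.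
    by rewrite -[LHS]ger0_norm ?expR_ge0// -sqrtr_sqr -expRM_natl; congr (Num.sqrt (expR _)); field.
  apply: sqrtr_le_sqr => //.
  by have := @expR_le_quadratic R 1; rewrite normr1 => /(_ (lexx _)); lra.
have : ln (2 ^+ j0 n) <= L :> R.
  by rewrite ler_ln ?posrE ?exprn_gt0// -natrX ler_nat pow_j0_le.
rewrite lnXn// => h.
have : (j0 n)%:R * (1 / 2) <= L by rewrite (le_trans _ h)// -[leRHS]mulr_natl ler_wpM2l.
have -> : (j0 n).+2%:R = (j0 n)%:R + 2 :> R by rewrite -addn2 natrD.
by lra.
Qed.

(** Here [e^(-11 L / 10)] is [e^(-L / 10) / n], and the constants are at most
    [L / 10 <= e^(L / 10)]. There remain at most [4 L] levels, which gives [8 L / n]. *)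
Lemma remainder_sum_le :
  remainder_cst * ((j0 n).+2%:R * Rad) <= 12 * L * n%:R^-1.
Proof.
have n0 : 0 < n%:R :> R by rewrite ltr0n.
have L_ge' := L_ge; have lnL_ge' := lnL_ge; have L_ge_cst' := L_ge_cst.
have R0 := Fclass_radius_ge0 f_class.
have K0 : 0 <= small_risk_cst :> R by rewrite addr_ge0 ?mulr_ge0 ?expR_ge0.
have eL : expR (- (11 / 10 * L)) = n%:R^-1 * expR (- (L / 10)).
  rewrite -[n%:R^-1]lnK ?posrE ?invr_gt0// lnV ?posrE// -expRD; congr expR; lra.
have L0 : 0 <= L by have := expR_ge0 (1 : R); lra.
have c0 : 0 <= small_risk_cst * (Rad + 1) * Rad by rewrite !mulr_ge0// addr_ge0.
have eL10 : small_risk_cst * (Rad + 1) * Rad * expR (- (L / 10)) <= 1.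
  rewrite -[leRHS](expRxMexpNx_1 (L / 10)).
  rewrite ler_wpM2r ?expR_ge0//; have := expR_ge1Dx (L / 10); lra.
rewrite /remainder_cst eL.
have -> : 2 * small_risk_cst * (n%:R^-1 * expR (- (L / 10))) * (Rad + 1) * ((j0 n).+2%:R * Rad) =
  2 * (j0 n).+2%:R * (small_risk_cst * (Rad + 1) * Rad * expR (- (L / 10))) / n%:R by ring.
rewrite ler_wpM2r ?invr_ge0 ?(ltW n0)//.
apply: (@le_trans _ _ (2 * (4 * L) * 1)); last lra.
by apply: ler_pM => //; rewrite ?mulr_ge0 ?addr_ge0 ?expR_ge0 ?ler_wpM2l ?log_level_le.
Qed.

Lemma oracle_inequality :
  (\int[P]_w (\int[leb]_x ((f_tilde n gam (N w) x - f x) ^+ 2)%:E)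
     <= (12 * L)%:E *
        ((\esum_(l in Gamma n) (Num.min (beta f l ^+ 2) (V n f l))%:E) + (n%:R^-1)%:E))%E.
Proof.
have n0 : 0 < n%:R :> R by rewrite ltr0n.
have L_ge' := L_ge; have lnL_ge' := lnL_ge; have L_ge_cst' := L_ge_cst.
have intf := Fclass_integrable f_class; have R0 := Fclass_radius_ge0 f_class.
have L0 : 1 <= L by have := expR_ge1Dx (1 : R); lra.
have K0 : 0 <= small_risk_cst :> R by rewrite addr_ge0 ?mulr_ge0 ?expR_ge0.
have C0 : 0 <= remainder_cst by rewrite !mulr_ge0 ?expR_ge0// addr_ge0.
have beta0 i k : ((j0 n).+1 < i)%N -> beta f (haar_index i k) = 0.
  apply: (Fclass_beta0 f_class n_gt0); rewrite (lt_le_trans L_gt_Rad)//.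
  by rewrite ler_peMr//; lra.
(* Extended by 0 outside [Gamma n], so as to be measurable at every index. *)
pose loss l w : \bar R :=
  if l \in Gamma n then ((kept_coefficient (N w) l - beta f l) ^+ 2)%:E else 0%E.
have loss0 l w : (0 <= loss l w)%E by rewrite /loss; case: ifP => // _; rewrite lee_fin sqr_ge0.
have Gamma_index l : Gamma n l -> exists2 i, (i < (j0 n).+2)%N & exists k, l = haar_index i k.
  by rewrite GammaE => -[i iJ [k _ <-]]; exists i => //; exists k.
have mloss l : measurable_fun setT (loss l).
  rewrite /loss; case: (boolP (l \in Gamma n)) => [/set_mem /Gamma_index[i _ [k ->]]|_].
    exact: measurable_coefficient_loss.
  exact: measurable_cst.
(* Truncation at 0 makes these nonnegative at every index, as the summation lemmas ask; on [Gamma n]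
   it changes nothing. *)
pose pmin l : R := Num.max 0 (Num.min (beta f l ^+ 2) (V n f l)).
pose pF l : R := Num.max 0 (bigF f l).
have F0 l : Gamma n l -> pF l = bigF f l.
  move=> /Gamma_index[i _ [k ->]]; rewrite /pF max_r//; exact: bigF_ge0 f_class _ _.
have min0 l : Gamma n l -> pmin l = Num.min (beta f l ^+ 2) (V n f l).
  move=> /Gamma_index[i _ [k ->]]; rewrite /pmin max_r// le_min sqr_ge0 VE//.
  by rewrite /= mulr_ge0 ?invr_ge0// mulr_ge0 ?sqr_ge0// (bigF_ge0 f_class).
apply: (@le_trans _ _ (\int[P]_w (\esum_(l in Gamma n) loss l w))%E).
  apply: le_integral_nneg => w.
    by apply: integral_ge0 => x _; rewrite lee_fin sqr_ge0.
  apply: (le_trans (haar_loss (kept_coefficient (N w)) intf beta0)).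
  by apply: le_esum => l Gl; rewrite /loss mem_set.
rewrite integral_esum//.
apply: (@le_trans _ _ (\esum_(l in Gamma n)
  ((12 * L)%:E * (pmin l)%:E + remainder_cst%:E * (pF l)%:E))%E).
  apply: le_esum => l Gl; rewrite F0// min0//.
  have [i iJ [k lE]] := Gamma_index _ Gl.
  rewrite -!EFinM -EFinD lE; apply: le_trans (coefficient_risk k iJ).
  rewrite le_eqVlt; apply/orP; left; apply/eqP; apply: eq_integral => w _.
  by rewrite /loss mem_set// -lE.
have pmin0 l : 0 <= pmin l by rewrite le_max lexx.
have pF0 l : 0 <= pF l by rewrite le_max lexx.
rewrite esumD; last 2 first.
- by move=> l _; rewrite -EFinM lee_fin mulr_ge0//; lra.
- by move=> l _; rewrite -EFinM lee_fin mulr_ge0.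
rewrite !esum_cmul//; [|by move=> l; rewrite lee_fin..|lra].
rewrite muleDr//; last by apply: ge0_adde_def; rewrite inE ?lee_fin ?invr_ge0 ?(ltW n0)//;
  apply: esum_ge0 => l Gl; rewrite -min0// lee_fin.
rewrite leeD//.
  rewrite lee_wpmul2l ?lee_fin//; first lra.
  by apply: le_esum => l Gl; rewrite min0.
apply: (@le_trans _ _ (remainder_cst * ((j0 n).+2%:R * Rad))%:E); last first.
  by rewrite -EFinM lee_fin remainder_sum_le.
rewrite (EFinM remainder_cst) lee_wpmul2l ?lee_fin//.
rewrite esum_Gamma; last by move=> l; rewrite lee_fin.
apply: (@le_trans _ _ (\sum_(i < (j0 n).+2) Rad%:E)%E).
  apply: lee_sum => i _; apply: le_trans (esum_dyadic_integral f_class i.-1).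
  apply: le_esum => k _; rewrite -bigF_dyadic// F0// GammaE.
  by exists i => //=; exists k.
by rewrite sumEFin sumr_const card_ord lee_fin mulr_natl.
Qed.

End OracleInequality.

(** * Choice of the rank [n0] *)

Theorem theorem2 (R : realType) (Rad : R) : 0 < Rad ->
  let gam : R := 1 + Num.sqrt 2 in
  exists n0 : nat, forall n : nat, (n0 <= n)%N ->
  forall f : R -> R, Fclass n Rad f ->
  forall (d : measure_display) (Omega : measurableType d)
         (P : probability Omega R) (N : Omega -> seq R),
  is_poisson_process P N (fun x => n%:R * f x) ->
  (\int[P]_w (\int[leb]_x ((f_tilde n gam (N w) x - f x) ^+ 2)%:E)
     <= (12 * ln n%:R)%:E *
        ((\esum_(l in Gamma n) (Num.min (beta f l ^+ 2) (V n f l))%:E) + (n%:R^-1)%:E))%E.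
Proof.
move=> Rad_gt0 gam.
(* The summands are nonnegative, so [ln n >= K] yields each requirement of [oracle_inequality];
   [e^1000] is there for [ln (ln n) >= 1000]. *)
pose K : R := 20 * expR 1 + expR 1000 + (Rad + 1)
  + 10 * (small_risk_cst * (Rad + 1) * Rad).
exists (Num.bound (expR K)).+1 => n n0n f f_class d Omega P N N_poisson.
have n_gt0 : (0 < n)%N by exact: leq_ltn_trans n0n.
have e1 := expR_ge0 (1 : R); have e1000 := expR_gt0 (1000 : R).
have c0 : 0 <= 10 * (small_risk_cst * (Rad + 1) * Rad).
  by rewrite !mulr_ge0 ?addr_ge0 ?mulr_ge0 ?expR_ge0 ?(ltW Rad_gt0).
have K_le : K <= ln n%:R.
  rewrite -ler_expR lnK ?posrE ?ltr0n//.
  rewrite (le_trans (ltW (archi_boundP (expR_ge0 K))))// ler_nat.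
  exact: ltnW.
rewrite /K in K_le; apply: (oracle_inequality f_class N_poisson) => //.
- lra.
- by rewrite -ler_expR lnK ?posrE; lra.
- lra.
- lra.
Qed.
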